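(* There exist a norm $\varphi$ on $\mathbb{R}^2$ whose unit ball $\{\varphi\le1\}$ has at least one boundary facet, an open, bounded, Pareto efficient set $\mathrm{U}\subseteq\mathbb{R}^2$ that is not compatible with $\varphi$, and a bounded, strictly positive, continuous function $f$ on $\mathrm{U}$, such that, with probability one, the rescaled height functions $\bar u_n=n^{-1/2}u_{X_{nf}}$, where $X_{nf}$ is a Poisson point process in $\mathrm{U}$ of intensity $nf$, do not converge uniformly in $\bar{\mathrm{U}}$ to a continuous function as $n\to\infty$.
   Context: **Geometry of the norm.** $\langle\cdot,\cdot\rangle$ and $\|\cdot\|$ are the Euclidean inner product and norm; $x\times y=x_1y_2-x_2y_1$. The dual norm is $\varphi^*(p)=\max\{\langle p,q\rangle/\varphi(q): q\neq0\}$, and $\mathcal{N}^*=\{p:\varphi^*(p)=1,\ \#\partial\varphi^*(p)>1\}$ with $\partial\varphi^*$ the subdifferential. For $p\in\mathcal{N}^*$ let $\mathcal{Q}_p=\{q:\langle q,p\rangle=\varphi(q)\}$ and let $v_p,w_p$ be the vectors with $\|v_p\|=\|w_p\|=1$, $w_p\times v_p>0$ and $\mathcal{Q}_p=\{c v_p-d w_p: c,d\ge 0\}$. Define $Q_p=\{a w_p+b v_p: a,b\ge 0\}$. **Pareto hull peeling.** For compact $A\subseteq\mathbb{R}^2$, $\mathcal{P}(A)=\{x\in\mathbb{R}^2:\forall y\neq x\ \exists a\in A\text{ with }\varphi(a-x)<\varphi(a-y)\}$, and $\mathcal{P}(\emptyset)=\emptyset$. For finite $A$, $E_1(A)=\mathcal{P}(A)$,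 $E_{k+1}(A)=\mathcal{P}(A\cap \mathrm{int}(E_k(A)))$, and $u_A=\sum_{k\ge1}1_{\mathrm{int}(E_k(A))}$ on $\mathbb{R}^2$. **Domains.** A bounded open $\mathrm{U}$ is Pareto efficient if $\mathrm{int}(\mathcal{P}(\bar{\mathrm{U}}))=\mathrm{U}$. A convex cone $Q$ supports $\mathrm{U}$ at $x_0\in\partial\mathrm{U}$ if $x_0\in(x_0+Q)\cap\bar{\mathrm{U}}$ and $(x_0+Q)\cap\bar{\mathrm{U}}\subseteq\partial\mathrm{U}$. A Pareto efficient $\mathrm{U}$ is compatible with $\varphi$ if for each $x_0\in\partial\mathrm{U}$ there are a convex cone $\tilde Q$ supporting $\mathrm{U}$ at $x_0$ and a $p\in\mathcal{N}^*$ with $Q_p\subseteq\tilde Q$. All the processes $X_{nf}$ are defined on a common probability space. *)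

(* Defs.v *)
From HB Require Import structures.
From mathcomp Require Import all_boot all_order all_algebra.
From mathcomp Require Import all_classical all_reals all_analysis.
From mathcomp Require Import measurable_realfun.
Import Order.TTheory GRing.Theory Num.Theory.
Import numFieldNormedType.Exports.

Set Implicit Arguments.
Unset Strict Implicit.
Unset Printing Implicit Defensive.

Local Open Scope classical_set_scope.
Local Open Scope ring_scope.

(* The library's sup norm on the product serves only for its topology and for
   boundedness; both are those of the Euclidean plane. *)
Notation plane R := (R * R)%type.

(* Same carrier, with the Borel sigma-algebra on which [lebesgue_measure] is
   declared. *)
Notation mplane R := (measurableTypeR R * measurableTypeR R)%type.

Section Geometry.
Context {R : realType}.
Implicit Types (phi psi : plane R -> R) (p q x y v w : plane R).
Implicit Types (A F K Q U : set (plane R)).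

Definition dot x y : R := x.1 * y.1 + x.2 * y.2.
Definition cross x y : R := x.1 * y.2 - x.2 * y.1.
Definition enorm x : R := Num.sqrt (dot x x).

Definition is_norm phi : Prop :=
  [/\ forall x, phi x = 0 -> x = 0,
      forall (c : R) x, phi (c *: x) = `|c| * phi x
    & forall x y, phi (x + y) <= phi x + phi y].

Definition unit_ball phi : set (plane R) := [set q | phi q <= 1].

(* A facet of a convex body of the plane is its intersection with a supporting
   line, when that intersection is not a single point. *)
Definition is_facet K F : Prop :=
  exists (p : plane R) (c : R),
    [/\ p != 0, forall q, K q -> dot p q <= c,
        F = K `&` [set q | dot p q = c]
      & exists a b, [/\ F a, F b & a != b]].

Definition boundary U : set (plane R) := closure U `\` interior U.

(* For a norm [phi] the quotients are bounded and the supremum is attained. *)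
Definition dual_norm phi p : R :=
  sup [set dot p q / phi q | q in [set q | q != 0]].

Definition subdifferential psi p : set (plane R) :=
  [set q | forall p', psi p + dot q (p' - p) <= psi p'].

Definition Nstar phi : set (plane R) :=
  [set p | dual_norm phi p = 1 /\
     exists q q', [/\ subdifferential (dual_norm phi) p q,
                      subdifferential (dual_norm phi) p q' & q != q']].

Definition calQ phi p : set (plane R) := [set q | dot q p = phi q].

Definition is_frame phi p v w : Prop :=
  [/\ enorm v = 1, enorm w = 1, 0 < cross w v
    & calQ phi p =
      [set x | exists c d : R, [/\ 0 <= c, 0 <= d & x = c *: v - d *: w]]].

(* For [p] in [Nstar phi] exactly one pair [v], [w] satisfies [is_frame]. *)
Definition Qcone phi p : set (plane R) :=
  [set x | exists v w (a b : R),
     [/\ is_frame phi p v w, 0 <= a, 0 <= b & x = a *: w + b *: v]].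

(* [pareto phi set0 = set0] is not a separate clause: every [x] admits some
   [y != x], and no [a] belongs to [set0]. *)
Definition pareto phi A : set (plane R) :=
  [set x | forall y, y != x -> exists2 a, A a & phi (a - x) < phi (a - y)].

Lemma pareto_set0 phi : pareto phi set0 = set0.
Proof.
apply/seteqP; split=> // -[x1 x2] /= xP.
have /xP[a []//] : (x1 + 1, x2) != (x1, x2) :> plane R.
by apply/eqP => -[] /eqP; rewrite -subr_eq0 addrAC subrr add0r oner_eq0.
Qed.

(* Indices are shifted: [peel phi A k] is E_(k+1)(A). *)
Fixpoint peel phi A (k : nat) : set (plane R) :=
  if k is k'.+1 then pareto phi (A `&` interior (peel phi A k'))
  else pareto phi A.

(* For finite [A] at most #|A| terms are nonzero: in the plane [pareto phi A] is
   contained in the convex hull of [A], so an extreme point of the hull is not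
   interior to [pareto phi A], and each peel discards a point. *)
Definition height phi A x : R :=
  limn (series (fun k => \1_(interior (peel phi A k)) x : R)).

Definition pareto_efficient phi U : Prop :=
  interior (pareto phi (closure U)) = U.

(* Scaling by [c = 0] is not required; a cone that supports a set contains 0. *)
Definition convex_cone Q : Prop :=
  (forall x y, Q x -> Q y -> Q (x + y)) /\
  (forall (c : R) x, 0 < c -> Q x -> Q (c *: x)).

Definition translate (x0 : plane R) Q : set (plane R) := [set x0 + q | q in Q].

Definition supports Q U (x0 : plane R) : Prop :=
  (translate x0 Q `&` closure U) x0 /\
  translate x0 Q `&` closure U `<=` boundary U.

Definition compatible phi U : Prop :=
  forall x0, boundary U x0 ->
    exists Q p, [/\ convex_cone Q, supports Q U x0, Nstar phi p
                  & Qcone phi p `<=` Q].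

End Geometry.

Section PoissonProcess.
Context {R : realType} {d : measure_display} {Omega : measurableType d}.
Variable P : probability Omega R.

Definition lebesgue2 : {measure set (mplane R) -> \bar R} :=
  (lebesgue_measure \x lebesgue_measure)%E.

Definition mutually_independent (m : nat) (N : 'I_m -> Omega -> \bar R) : Prop :=
  forall C : 'I_m -> set (\bar R), (forall i, measurable (C i)) ->
    P (\bigcap_i (N i @^-1` C i)) = (\prod_(i < m) P (N i @^-1` C i))%E.

Definition points_in (X : Omega -> set (plane R)) (B : set (mplane R)) :
  Omega -> \bar R := fun w => counting (X w `&` B).

(* [g] is meant to be integrable on [U]; the points are then almost surely
   finitely many. [poisson_prob] is used rather than [poisson_pmf] because it is
   the Dirac mass at 0 when the mean is 0, whereas the latter is constantly 1;
   [poisson_prob] ignores its second argument. *)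
Definition poisson_process (U : set (plane R)) (g : plane R -> R)
    (X : Omega -> set (plane R)) : Prop :=
  [/\ forall w, X w `<=` U,
      forall B : set (mplane R),
        measurable B -> measurable_fun setT (points_in X B),
      forall (B : set (mplane R)) (k : nat), measurable B ->
        P [set w | points_in X B w = k%:R%:E] =
        poisson_prob (\int[lebesgue2]_(x in U `&` B) g x) k [set k]
    & forall m (B : 'I_m -> set (mplane R)),
        (forall i, measurable (B i)) -> trivIset setT B ->
        mutually_independent (fun i => points_in X (B i))].

End PoissonProcess.

Definition rescaled_height {R : realType} (phi : plane R -> R) (n : nat)
    (A : set (plane R)) (x : plane R) : R :=
  n%:R `^ (- 2^-1) * height phi A x.

(* Main.v *)
Require Import Defs.
From HB Require Import structures.
From mathcomp Require Import all_boot all_order all_algebra.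
From mathcomp Require Import all_classical all_reals all_analysis.
From mathcomp Require Import measurable_realfun finmap ring lra zify.
Import Order.TTheory GRing.Theory Num.Theory.
Import numFieldNormedType.Exports.

Local Open Scope classical_set_scope.
Local Open Scope ring_scope.

(* Take U = ]-1, 1[^2, f = 1, and for the unit ball a stadium: the square [-1, 1]^2
   with half discs of radius 1 glued to its left and right sides, so that the only
   facets are horizontal. A point a of a finite set A that is not interior to the
   hull of A has either no point of A in one of the two horizontal cones
   |x2| < +-x1 at a, or a line of slope in [-1, 1] through a with A on one side.
   Hence each layer meets the strip 1 - 1/D < x2 < 1 in two 1-Lipschitz graphs over
   x2, which have O(n^(1/2) / D) points because they span only the height of the
   strip, and two convex chains, which have o(n^(1/2)) points. If the rescaled
   heights converged uniformly to a continuous g, then g would vanish on the top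
   side, so for large D the strip would be exhausted by n^(1/2) / 400 layers: too few
   to contain its n / D points. *)

(** * The norm *)

(** Horizontal facets give the dual ball corners at (0, 1) and (0, -1) only, and the cones Q_p
    attached to them are horizontal. At (0, 1), on the top side, each of them enters the square, so
    compatibility fails there. The obstacle is that a layer depends on the whole random set, so no
    tail bound applies to it. Layers are used only through chains that are monotone in suitable
    coordinates and lie in one of finitely many fixed windows; a union bound over the staircases of
    these windows covers all chains at once. A convex chain beats a Lipschitz one because, in a
    column of width 1/M and for slopes in a bucket of width 2/M, its shear rises by at most 2/M^2.
    About 2 M windows of area of order M^-3 then carry O(N / M^(1/2)) points at intensity N^2. With
    M = 4 m^2 fixed, this is a small multiple of N, which is enough. Only the intensities N^2 with N
    = 4 m^3 l are examined: a subsequence refutes convergence, and these values make the grid sizes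
    integers with mean at most 1 per cell. *)

Lemma half_subr_sqr_ge0 {R : realType} (t : R) : `|t| <= 1 -> 0 <= (1 - t ^+ 2) / 2.
Proof.
by move=> t1; rewrite divr_ge0// subr_ge0 -[t ^+ 2]real_normK ?num_real// expr_le1.
Qed.

Lemma normr_eq1 {R : realType} (e : R) : `|e| = 1 -> e = 1 \/ e = -1.
Proof. by move/eqP; rewrite eqr_norml ler01 andbT => /orP[]/eqP; [left|right]. Qed.

Lemma sqr_norm1 {R : realType} (e : R) : `|e| = 1 -> e * e = 1.
Proof. by move=> e1; rewrite -expr2 -[e ^+ 2]real_normK ?num_real// e1 expr1n. Qed.

(** The gauge of the stadium: where [|x.2| < |x.1|], the point [x / r] is on the unit circle about
    (1, 0) or (-1, 0) exactly when [x.1 ^+ 2 + x.2 ^+ 2 = 2 r |x.1|]. *)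
Definition stadium {R : realType} (x : plane R) : R :=
  if `|x.1| <= `|x.2| then `|x.2|
  else (x.1 ^+ 2 + x.2 ^+ 2) / (2 * `|x.1|).

(** At slope [t = x.2 / |x.1|] the gradient of [stadium] on the right half disc is ((1 - t^2) / 2,
    t). With both signs of the first coordinate, these vectors form two arcs of parabola that bound
    the dual ball and meet in corners at (0, 1) and (0, -1). *)
Definition stadium_lin {R : realType} (t : R) (x : plane R) : R :=
  (1 - t ^+ 2) / 2 * `|x.1| + t * x.2.

(** The gap between the gauge and a tangent functional is a square that vanishes at the slope of
    [x]. The boolean factor covers [x.1 = 0], where the left side is 0. *)
Lemma stadium_linP {R : realType} (t : R) (x : plane R) :
  `|x.1| * (2 * ((x.1 ^+ 2 + x.2 ^+ 2) / (2 * `|x.1|)) - 2 * stadium_lin t x) =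
  (x.2 - t * `|x.1|) ^+ 2 *+ (x.1 != 0).
Proof.
rewrite /stadium_lin; have [->|x0] := eqVneq x.1 0; first by rewrite normr0 mul0r.
have n0 : `|x.1| != 0 by rewrite normr_eq0.
rewrite -[x.1 ^+ 2]real_normK ?num_real//= mulr1n; field.
by rewrite n0.
Qed.

Lemma stadium_ge {R : realType} (t : R) (x : plane R) : `|t| <= 1 ->
  stadium_lin t x <= stadium x.
Proof.
move=> t1; rewrite /stadium; case: ifPn => [x12|].
  have t2 := half_subr_sqr_ge0 t t1.
  have : t * x.2 <= `|t| * `|x.2| by rewrite -normrM ler_norm.
  have : (1 - t ^+ 2) / 2 * `|x.1| <= (1 - t ^+ 2) / 2 * `|x.2|.
    exact: ler_wpM2l.
  have : 0 <= `|x.2| * (1 - `|t|) ^+ 2 by rewrite mulr_ge0 ?sqr_ge0.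
  rewrite /stadium_lin -[t ^+ 2]real_normK ?num_real//; lra.
rewrite -ltNge => x21; have n0 : 0 < `|x.1| by apply: le_lt_trans x21.
have := stadium_linP t x; rewrite (_ : x.1 != 0); last by rewrite -normr_gt0.
move=> /= H; have : 0 <= (x.2 - t * `|x.1|) ^+ 2 by exact: sqr_ge0.
by rewrite -[X in 0 <= X]mulr1n -H pmulr_rge0// -mulrBr pmulr_rge0// subr_ge0.
Qed.

(** With [stadium_ge], this makes [stadium] a maximum of the sublinear functions [stadium_lin t];
    the triangle inequality is inherited from them. *)
Lemma stadium_attained {R : realType} (x : plane R) :
  exists2 t : R, `|t| <= 1 & stadium x = stadium_lin t x.
Proof.
rewrite /stadium; case: ifPn => [x12|].
  exists (if 0 <= x.2 then 1 else -1); rewrite /stadium_lin; case: ifPn => x2.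
  - by rewrite normr1.
  - by rewrite normrN1.
  - by rewrite expr1n subrr !mul0r add0r mul1r ger0_norm.
  - rewrite sqrrN expr1n subrr !mul0r add0r mulN1r ler0_norm//.
    by apply/ltW; rewrite ltNge.
rewrite -ltNge => x21; have n0 : 0 < `|x.1| by apply: le_lt_trans x21.
exists (x.2 / `|x.1|).
  by rewrite normrM normfV normr_id ler_pdivrMr// mul1r ltW.
rewrite /stadium_lin -[x.1 ^+ 2]real_normK ?num_real//; field.
by rewrite lt0r_neq0.
Qed.

Lemma stadium_ge0 {R : realType} (x : plane R) : 0 <= stadium x.
Proof.
by rewrite /stadium; case: ifP => // _; rewrite divr_ge0// ?addr_ge0 ?sqr_ge0.
Qed.

Lemma stadium_ge2 {R : realType} (x : plane R) : `|x.2| <= stadium x.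
Proof.
rewrite ler_norml; apply/andP; split.
  have := @stadium_ge R (-1) x; rewrite normrN1 /stadium_lin sqrrN expr1n => /(_ (lexx _)).
  lra.
have := @stadium_ge R 1 x; rewrite normr1 /stadium_lin expr1n => /(_ (lexx _)); lra.
Qed.

Lemma stadium_ge1 {R : realType} (x : plane R) : `|x.1| / 2 <= stadium x.
Proof.
have := @stadium_ge R 0 x; rewrite normr0 /stadium_lin expr0n/= => /(_ ler01); lra.
Qed.

Lemma stadium_eq0 {R : realType} (x : plane R) : stadium x = 0 -> x = 0.
Proof.
move=> x0; have := stadium_ge2 x; have := stadium_ge1 x; rewrite x0.
rewrite ler_pdivrMr// mul0r !normr_le0; case: x {x0} => x1 x2 /=.
by move=> /eqP -> /eqP ->.
Qed.

Lemma stadium_gt0 {R : realType} (x : plane R) : x != 0 -> 0 < stadium x.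
Proof.
move=> x0; rewrite lt_neqAle stadium_ge0 andbT eq_sym.
by apply: contra_neq x0 => /stadium_eq0.
Qed.

Lemma stadium0 {R : realType} : stadium 0 = 0 :> R.
Proof. by rewrite /stadium/= normr0 lexx. Qed.

Lemma stadiumZ {R : realType} (c : R) (x : plane R) :
  stadium (c *: x) = `|c| * stadium x.
Proof.
have [->|c0] := eqVneq c 0; first by rewrite scale0r normr0 mul0r stadium0.
have nc : 0 < `|c| by rewrite normr_gt0.
rewrite /stadium /= /GRing.scale/= !normrM ler_pM2l//.
case: ifPn => // x12; have x1 : `|x.1| != 0.
  by apply: contraNneq x12 => ->.
rewrite !exprMn -[c ^+ 2]real_normK ?num_real//; field.
by rewrite x1 lt0r_neq0.
Qed.

Lemma stadiumD {R : realType} (x y : plane R) :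
  stadium (x + y) <= stadium x + stadium y.
Proof.
have [t t1 ->] := stadium_attained (x + y).
apply: le_trans _ (lerD (stadium_ge t x t1) (stadium_ge t y t1)).
have t2 := half_subr_sqr_ge0 t t1.
rewrite /stadium_lin/= addrACA -!mulrDr lerD2r ler_wpM2l//.
exact: ler_normD.
Qed.

Lemma stadium_norm {R : realType} : is_norm (@stadium R).
Proof.
split; [exact: stadium_eq0|exact: stadiumZ|exact: stadiumD].
Qed.

Lemma stadium_top {R : realType} (x : plane R) :
  `|x.1| <= `|x.2| -> stadium x = `|x.2|.
Proof. by rewrite /stadium => ->. Qed.

Lemma stadium_facet {R : realType} :
  exists F, is_facet (unit_ball (@stadium R)) F.
Proof.
exists (unit_ball stadium `&` [set q | dot (0, 1) q = 1]); exists (0, 1), 1.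
have dotE (q : plane R) : dot (0, 1) q = q.2 by rewrite /dot mul0r mul1r add0r.
split=> //.
- by apply/eqP => -[] /eqP; rewrite oner_eq0.
- move=> q qB; rewrite dotE; apply: le_trans (ler_norm _) _.
  exact: le_trans (stadium_ge2 q) qB.
- exists (0, 1), (1, 1); split.
  + by split; rewrite /= ?dotE// /unit_ball/= stadium_top/= ?normr0 normr1.
  + by split; rewrite /= ?dotE// /unit_ball/= stadium_top/= normr1.
  + by apply/eqP => -[] /eqP; rewrite eq_sym oner_eq0.
Qed.

Lemma stadium_mono {R : realType} (x y : plane R) :
  `|x.1| <= `|y.1| -> `|x.2| <= `|y.2| -> stadium x <= stadium y.
Proof.
move=> xy1 xy2; have [t t1 ->] := stadium_attained x.
apply: le_trans (_ : stadium_lin `|t| (y.1, `|y.2|) <= _).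
  rewrite /stadium_lin [ `|t| ^+ 2]real_normK ?num_real//= lerD//.
    exact: ler_wpM2l (half_subr_sqr_ge0 t t1) _ _ xy1.
  apply: le_trans (ler_norm _) _; rewrite normrM ler_wpM2l//.
apply: le_trans (stadium_ge _ _ _) _; first by rewrite normr_id.
by rewrite /stadium/= normr_id real_normK// num_real.
Qed.

(** * The dual norm and its corners *)

Lemma dual_stadium_has_sup {R : realType} (p : plane R) :
  has_sup [set dot p q / stadium q | q in [set q : plane R | q != 0]].
Proof.
split.
  exists (dot p (1, 0) / stadium (1, 0)); exists (1, 0) => //=.
  by apply/eqP => -[] /eqP; rewrite oner_eq0.
exists (2 * `|p.1| + `|p.2|) => _ [q q0 <-].
have sq := stadium_gt0 q q0.
rewrite ler_pdivrMr//; apply: le_trans (ler_norm _) _.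
apply: le_trans (ler_normD _ _) _; rewrite !normrM mulrDl lerD//.
  by rewrite [2 * _]mulrC -mulrA ler_wpM2l// mulrC -ler_pdivrMr// stadium_ge1.
by rewrite ler_wpM2l// stadium_ge2.
Qed.

Lemma dot_le_dual {R : realType} (p q : plane R) :
  dot p q <= dual_norm stadium p * stadium q.
Proof.
have [->|q0] := eqVneq q 0; first by rewrite /dot !mulr0 addr0 stadium0 mulr0.
have sq := stadium_gt0 q q0.
rewrite -ler_pdivrMr//; apply: (ub_le_sup (dual_stadium_has_sup p).2).
by exists q.
Qed.

Lemma dual_le1 {R : realType} (p : plane R) :
  (forall q, dot p q <= stadium q) -> dual_norm stadium p <= 1.
Proof.
move=> pq; apply: ge_sup; first exact: (dual_stadium_has_sup p).1.
move=> _ [q q0 <-]; have sq := stadium_gt0 q q0.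
by rewrite ler_pdivrMr// mul1r.
Qed.

Lemma dual_normZ2 {R : realType} (p : plane R) :
  dual_norm stadium (2 *: p) <= 2 * dual_norm stadium p.
Proof.
apply: ge_sup; first exact: (dual_stadium_has_sup _).1.
move=> _ [q q0 <-].
have sq := stadium_gt0 q q0.
rewrite ler_pdivrMr// -mulrA.
have := dot_le_dual p q; rewrite /dot /= /GRing.scale/=; lra.
Qed.

(** At 0 and [2 *: p] the subgradient inequality yields Euler's identity [dot q p = 1]. At [p'], a
    functional of dual norm at most 1 that attains [stadium q], it yields [stadium q <= 1]. *)
Lemma subdiff_dual_stadium {R : realType} (p q : plane R) :
  dual_norm stadium p = 1 -> subdifferential (dual_norm stadium) p q ->
  [/\ dot p q = 1 & stadium q = 1].
Proof.
move=> p1 qp.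
have d0 : dual_norm (@stadium R) 0 <= 0.
  apply: ge_sup; first exact: (dual_stadium_has_sup _).1.
  by move=> _ [r r0 <-]; rewrite /dot !mul0r addr0 mul0r.
have dotC : dot p q = dot q p by rewrite /dot mulrC [p.2 * _]mulrC.
have := qp 0; rewrite sub0r {1}/dot/= !mulrN p1 => h0.
have := qp (2 *: p); rewrite p1 => h2; have h3 := dual_normZ2 p; rewrite p1 mulr1 in h3.
have pq1 : dot q p = 1.
  move: h0 h2 h3 d0; rewrite /dot/= /GRing.scale/=; lra.
rewrite dotC; split => //.
have q1 : 1 <= stadium q by have := dot_le_dual p q; rewrite dotC pq1 p1 mul1r.
apply/eqP; rewrite eq_le q1 andbT.
have [t t1 ->] := stadium_attained q.
pose s : R := if 0 <= q.1 then 1 else -1.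
have s1 : s * q.1 = `|q.1|.
  rewrite /s; case: ifPn => h; first by rewrite mul1r ger0_norm.
  by rewrite mulN1r ler0_norm// ltW// ltNge.
have sle (x : R) : s * x <= `|x|.
  rewrite /s; case: ifP => _; first by rewrite mul1r ler_norm.
  by rewrite mulN1r -normrN ler_norm.
have tp := half_subr_sqr_ge0 t t1.
pose p' : plane R := ((1 - t ^+ 2) / 2 * s, t).
have dp' : dual_norm stadium p' <= 1.
  apply: dual_le1 => r; apply: le_trans _ (stadium_ge t r t1).
  by rewrite /dot /stadium_lin/= lerD2r -[_ * s * _]mulrA ler_wpM2l.
have := qp p'; rewrite p1.
have -> : dot q (p' - p) = stadium_lin t q - dot q p.
  by rewrite /dot /stadium_lin/= -s1; ring.
rewrite pq1; lra.
Qed.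

(** Two subgradients [q], [q'] span a segment of the unit sphere, so a functional [stadium_lin t]
    that attains [stadium (q + q')] equals 1 at both. If [t ^+ 2 = 1], the segment is horizontal and
    determines [p]; otherwise [q] and [q'] are the same point of a half circle. *)
Lemma Nstar_stadium {R : realType} (p : plane R) :
  Nstar stadium p -> p = (0, 1) \/ p = (0, -1).
Proof.
move=> [p1 [q [q' [qp q'p /eqP qq']]]].
have [dq sq] := subdiff_dual_stadium p q p1 qp.
have [dq' sq'] := subdiff_dual_stadium p q' p1 q'p.
have := dot_le_dual p (q + q'); rewrite p1 mul1r.
have -> : dot p (q + q') = 2 by move: dq dq'; rewrite /dot/=; lra.
have [t t1 ->] := stadium_attained (q + q') => h.
have tp := half_subr_sqr_ge0 t t1.
have lq : stadium_lin t q <= 1 by rewrite -sq stadium_ge.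
have lq' : stadium_lin t q' <= 1 by rewrite -sq' stadium_ge.
have habs : (1 - t ^+ 2) / 2 * `|q.1 + q'.1| <= (1 - t ^+ 2) / 2 * (`|q.1| + `|q'.1|).
  by rewrite ler_wpM2l// ler_normD.
have [tq tq'] : stadium_lin t q = 1 /\ stadium_lin t q' = 1.
  by move: h lq lq'; rewrite /stadium_lin/=; split; lra.
have hs : (1 - t ^+ 2) / 2 * `|q.1 + q'.1| = (1 - t ^+ 2) / 2 * (`|q.1| + `|q'.1|).
  move: h tq tq'; rewrite /stadium_lin/=; lra.
have [t_1|tn1] := eqVneq (t ^+ 2) 1.
  have q2 : t * q.2 = 1 by move: tq; rewrite /stadium_lin t_1; lra.
  have q2' : t * q'.2 = 1 by move: tq'; rewrite /stadium_lin t_1; lra.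
  have tt : t = 1 \/ t = -1.
    by move/eqP: t_1; rewrite sqrf_eq1 => /orP[/eqP|/eqP]; [left|right].
  have e2 : q.2 = q'.2 by case: tt q2 q2' => ->; lra.
  have e1 : q.1 != q'.1.
    by apply/eqP => e1; apply: qq'; move: e1 e2; case: (q) (q') => ? ? [? ?] /= -> ->.
  have p10 : p.1 = 0.
    have : p.1 * (q.1 - q'.1) = 0.
      have : dot p q - dot p q' = 0 by rewrite dq dq' subrr.
      by rewrite /dot e2; lra.
    by move/eqP; rewrite mulf_eq0 subr_eq0 (negbTE e1) orbF => /eqP.
  have p2 : p.2 * q.2 = 1 by move: dq; rewrite /dot p10; lra.
  move: p10 p2; case: (p) => p1' p2' /= -> p2.
  case: tt q2 => -> q2; [left|right]; congr pair.
    have q1 : q.2 = 1 by lra.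
    by move: p2; rewrite q1; lra.
  have q1 : q.2 = -1 by lra.
  by move: p2; rewrite q1; lra.
have tlt : 0 < (1 - t ^+ 2) / 2
  by rewrite lt_neqAle tp andbT eq_sym mulf_neq0 ?invr_eq0// subr_eq0 eq_sym.
exfalso.
(* On the round part of the sphere the support functional determines the point. *)
have uniq (r : plane R) : stadium r = 1 -> stadium_lin t r = 1 ->
    r.2 = t * `|r.1| /\ (1 + t ^+ 2) / 2 * `|r.1| = 1.
  move=> r1 tr.
  have [r12|r12] := leP `|r.1| `|r.2|.
    move: r1; rewrite stadium_top// => r2; exfalso.
    have t2 : t * r.2 <= `|t| by rewrite (le_trans (ler_norm _))// normrM r2 mulr1.
    have : (1 - t ^+ 2) / 2 * `|r.1| <= (1 - t ^+ 2) / 2 by rewrite ler_piMr// -r2.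
    move: tr; rewrite /stadium_lin.
    have tl : `|t| < 1.
      rewrite lt_neqAle t1 andbT; apply: contra_neq tn1 => tt.
      by rewrite -[t ^+ 2]real_normK ?num_real// tt expr1n.
    have : 0 < (1 - `|t|) * (1 - `|t|) by rewrite mulr_gt0// subr_gt0.
    rewrite -[t ^+ 2]real_normK ?num_real//; lra.
  have r0 : r.1 != 0 by rewrite -normr_gt0; apply: le_lt_trans r12.
  have := stadium_linP t r; rewrite r0 tr.
  have := r1; rewrite {1}/stadium leNgt r12/= => ->.
  rewrite mulr1 subrr mulr0 mulr1n => /esym/eqP; rewrite sqrf_eq0 subr_eq0 => /eqP r2.
  split=> //; move: tr; rewrite /stadium_lin r2; lra.
have [a1 a2] := uniq q sq tq; have [b1 b2] := uniq q' sq' tq'.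
have t20 : 0 <= t ^+ 2 by exact: sqr_ge0.
have ab : `|q.1| = `|q'.1|.
  have : (1 + t ^+ 2) / 2 != 0 by rewrite lt0r_neq0// divr_gt0//; lra.
  by move=> /mulfI; apply; rewrite a2 b2.
(* Equality in the triangle inequality excludes mirror images on opposite half circles. *)
have : `|q.1 + q'.1| = `|q.1| + `|q'.1| by apply: (mulfI (lt0r_neq0 tlt)).
have n0 : 0 < `|q.1|.
  rewrite lt_neqAle normr_ge0 andbT eq_sym; apply/eqP => q10.
  by move: a2; rewrite q10 mulr0 => /eqP; rewrite eq_sym oner_eq0.
have q1q : q.1 != q'.1.
  apply/eqP => e1; apply: qq'; move: e1 a1 b1.
  by case: (q) (q') => ? ? [? ?] /= -> -> ->.
have /orP[/eqP e|/eqP e] : (q.1 == q'.1) || (q.1 == - q'.1).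
- by rewrite -eqr_norm2 ab.
- by rewrite e eqxx in q1q.
- by move: n0; rewrite e addrC subrr normr0 normrN => n0 h1; lra.
Qed.

(** * The square *)

Lemma pareto_mono {R : realType} (phi : plane R -> R) (A B : set (plane R)) :
  A `<=` B -> pareto phi A `<=` pareto phi B.
Proof. by move=> AB x xA y /xA[a /AB Ba h]; exists a. Qed.

Lemma pareto_stadium_out {R : realType} (A : set (plane R)) (x y : plane R) :
  y != x ->
  (forall a, A a -> `|a.1 - y.1| <= `|a.1 - x.1| /\ `|a.2 - y.2| <= `|a.2 - x.2|) ->
  ~ pareto stadium A x.
Proof.
move=> yx h /(_ y yx)[a /h[h1 h2]]; apply/negP; rewrite -leNgt.
exact: stadium_mono.
Qed.

Lemma pareto_self {R : realType} (A : set (plane R)) : A `<=` pareto stadium A.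
Proof.
move=> a Aa y ya; exists a => //; rewrite subrr stadium0 stadium_gt0//.
by rewrite subr_eq0 eq_sym.
Qed.

Lemma pareto_le2 {R : realType} (A : set (plane R)) (c : R) :
  A `<=` [set x | x.2 <= c] -> pareto stadium A `<=` [set x | x.2 <= c].
Proof.
move=> Ac x xA /=; rewrite leNgt; apply/negP => cx.
apply: (pareto_stadium_out A x (x.1, c) _ _ xA).
  by apply/eqP => xe; move: cx; rewrite -xe/= ltxx.
move=> a /Ac/= ac; split=> //=.
by rewrite !ler0_norm; lra.
Qed.

Definition square {R : realType} : set (plane R) :=
  [set x | `|x.1| < 1 /\ `|x.2| < 1].

Definition csquare {R : realType} : set (plane R) :=
  [set x | `|x.1| <= 1 /\ `|x.2| <= 1].

Lemma squareE {R : realType} : @square R = ball (0 : plane R) 1.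
Proof.
apply/seteqP; split=> x; rewrite -ball_normE /ball_/= sub0r normrN /Num.norm/= gt_max.
  by case=> -> ->.
by case/andP.
Qed.

Lemma csquareE {R : realType} : @csquare R = closed_ball (0 : plane R) 1.
Proof.
rewrite closed_ballE// /closed_ball_; apply/seteqP; split=> x /=;
  rewrite sub0r normrN /Num.norm/= ge_max.
  by case=> -> ->.
by case/andP.
Qed.

Lemma open_square {R : realType} : open (@square R).
Proof. by rewrite squareE; exact: ball_open. Qed.

Lemma closure_square {R : realType} : closure (@square R) = csquare.
Proof. by rewrite squareE csquareE. Qed.

Lemma bounded_square {R : realType} : bounded_set (@square R).
Proof.
exists 1; split=> // M M1 x [x1 x2].
by rewrite /Num.norm/= ge_max !(ltW (lt_trans _ M1)).
Qed.

Lemma interior_csquare {R : realType} : interior (@csquare R) = square.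
Proof. by rewrite csquareE squareE interior_closed_ballE. Qed.

Lemma pareto_csquare {R : realType} : pareto stadium (@csquare R) = csquare.
Proof.
apply/seteqP; split; last exact: pareto_self.
(* Clamping the coordinates to [-1, 1] brings [x] closer, coordinatewise, to every point of the
   square, so a point that it moves is outside the hull. *)
move=> x xA; pose cl (t : R) := Num.max (-1) (Num.min 1 t).
have clP (t a : R) : `|a| <= 1 -> `|a - cl t| <= `|a - t|.
  rewrite ler_norml => /andP[a1 a2]; rewrite /cl.
  have [t1|t1] := leP t 1; last first.
    by rewrite max_r ?ler0_norm; lra.
  have [t2|t2] := leP (-1) t; first by [].
  by rewrite !ger0_norm; lra.
have cl1 (t : R) : cl t = t -> `|t| <= 1.
  rewrite /cl ler_norml => <-; rewrite le_max lexx/= ge_max ge_min lexx/= andbT.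
  by rewrite (@le_trans _ _ 0).
have [e|ne] := eqVneq (cl x.1, cl x.2) x.
  by split; apply: cl1; [exact: (congr1 fst e)|exact: (congr1 snd e)].
exfalso; apply: (pareto_stadium_out csquare x _ ne _ xA) => a [a1 a2].
by split; exact: clP.
Qed.

Lemma square_efficient {R : realType} : pareto_efficient stadium (@square R).
Proof.
by rewrite /pareto_efficient closure_square pareto_csquare interior_csquare.
Qed.

(** For [p = (0, e)], [calQ] is the vertical cone [|q.1| <= e * q.2], spanned by the diagonal unit
    vectors [v] and [- w]. Replacing [- w] by [w] turns it into the horizontal cone. *)
Lemma Qcone_stadium {R : realType} (e : R) (x : plane R) : `|e| = 1 ->
  `|x.2| <= e * x.1 -> Qcone stadium (0, e) x.
Proof.
move=> e1 xe; pose r : R := Num.sqrt 2^-1.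
have e2 := sqr_norm1 e e1.
have r2 : r * r = 2^-1 by rewrite -expr2 sqr_sqrtr// invr_ge0.
have r0 : 0 < r by rewrite sqrtr_gt0 invr_gt0.
have n1 (a b : R) : `|a| = r -> `|b| = r -> enorm (a, b) = 1.
  move=> ar br; rewrite /enorm /dot/= -!expr2 -[a ^+ 2]real_normK ?num_real//.
  rewrite -[b ^+ 2]real_normK ?num_real// ar br !expr2 r2 -[RHS]sqrtr1; congr Num.sqrt; lra.
have er : `|e * r| = r by rewrite normrM e1 mul1r gtr0_norm.
exists (e * r, e * r), (e * r, - (e * r)), (r * (e * x.1 - x.2 * e)), (r * (e * x.1 + e * x.2)).
have ab : `|e * x.2| <= e * x.1 by rewrite normrM e1 mul1r.
move: ab; rewrite ler_norml => /andP[ab1 ab2].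
have eE (t : R) : e * (e * t) = t by rewrite mulrA e2 mul1r.
split.
- split; first by apply: n1; rewrite er.
  + by apply: n1; rewrite ?normrN er.
  + rewrite /cross/=; have -> : e * r * (e * r) - - (e * r) * (e * r)
    = (e * e) * (r * r) * 2 by ring.
    by rewrite e2 r2 mul1r mulVf.
  apply/seteqP; split=> q /=; rewrite /calQ/= /dot/= mulr0 add0r.
    move=> qe.
    have q12 : `|q.1| <= e * q.2.
      have [q12|q12] := leP `|q.1| `|q.2|.
        by rewrite mulrC qe stadium_top.
      have q0 : q.1 != 0 by rewrite -normr_gt0; apply: le_lt_trans q12.
      move: qe; rewrite /stadium leNgt q12/= => /(congr1 (fun z => z * (2 * `|q.1|))).
      rewrite divfK ?mulf_neq0 ?normr_eq0// -[q.1 ^+ 2]real_normK ?num_real// => h.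
      suff : (`|q.1| - e * q.2) ^+ 2 == 0 by rewrite sqrf_eq0 subr_eq0 => /eqP ->.
      by apply/eqP; move: h; rewrite sqrrB exprMn (expr2 e) e2; lra.
    have q12' : `|e * q.1| <= e * q.2 by rewrite normrM e1 mul1r.
    move: q12'; rewrite ler_norml => /andP[q1' q2'].
    exists (r * (e * q.2 + e * q.1)), (r * (e * q.2 - e * q.1)); split.
    + by rewrite mulr_ge0 ?(ltW r0)//; lra.
    + by rewrite mulr_ge0 ?(ltW r0)//; lra.
    + rewrite [LHS]surjective_pairing; congr pair; rewrite /GRing.scale/=.
        have -> : r * (e * q.2 + e * q.1) * (e * r) - r * (e * q.2 - e * q.1) * (e * r)
          = (r * r) * (e * (e * q.1)) * 2 by ring.
        by rewrite r2 eE mulrAC mulVf ?mul1r.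
      have -> : r * (e * q.2 + e * q.1) * (e * r) - r * (e * q.2 - e * q.1) * - (e * r)
        = (r * r) * (e * (e * q.2)) * 2 by ring.
      by rewrite r2 eE mulrAC mulVf ?mul1r.
  move=> [c [d [c0 d0 ->]]].
  have -> : c *: (e * r, e * r) - d *: (e * r, - (e * r))
    = (e * (r * (c - d)), e * (r * (c + d))) :> plane R.
    by congr pair; rewrite /= /GRing.scale/=; ring.
  have cd : `|c - d| <= c + d by rewrite ler_norml; lra.
  rewrite /= mulrC eE stadium_top/=; last first.
    by rewrite !normrM e1 !mul1r ler_pM2l ?normr_gt0 ?lt0r_neq0//;
      apply: le_trans cd (ler_norm _).
  by rewrite !normrM e1 mul1r gtr0_norm// ger0_norm// addr_ge0.
- by rewrite mulr_ge0 ?(ltW r0)//; lra.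
- by rewrite mulr_ge0 ?(ltW r0)//; lra.
- rewrite [LHS]surjective_pairing; congr pair; rewrite /GRing.scale/=.
    have -> : r * (e * x.1 - x.2 * e) * (e * r) + r * (e * x.1 + e * x.2) * (e * r)
      = (r * r) * (e * (e * x.1)) * 2 by ring.
    by rewrite r2 eE mulrAC mulVf ?mul1r.
  have -> : r * (e * x.1 - x.2 * e) * - (e * r) + r * (e * x.1 + e * x.2) * (e * r)
    = (r * r) * (e * (e * x.2)) * 2 by ring.
  by rewrite r2 eE mulrAC mulVf ?mul1r.
Qed.

Lemma square_incompatible {R : realType} : ~ compatible stadium (@square R).
Proof.
move=> /(_ (0, 1)) []; first split.
- by rewrite closure_square; split; rewrite /= ?normr0 ?normr1.
- by rewrite (interior_id _).1; [move=> []; rewrite /= normr1 ltxx|exact: open_square].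
move=> Q [p [_ [_ Qs] Np pQ]].
suff [e [e1 pe]] : exists e : R, `|e| = 1 /\ p = (0, e).
  (* A vector of the horizontal cone that leads from (0, 1) down into the open square. *)
  pose x : plane R := (e / 2, - 4^-1).
  have Qx : Q x.
    apply: pQ; rewrite pe; apply: Qcone_stadium => //=.
    rewrite mulrA -expr2 -[e ^+ 2]real_normK ?num_real// e1 normrN expr1n gtr0_norm; lra.
  have xU : square ((0, 1) + x).
    split=> /=; rewrite ?add0r; first by rewrite normrM e1 mul1r gtr0_norm; lra.
    by rewrite gtr0_norm; lra.
  have [] : boundary square ((0, 1) + x).
    by apply: Qs; split; [exists x|exact: subset_closure].
  by move=> _; rewrite (interior_id _).1//; exact: open_square.
by case: (Nstar_stadium p Np) => ->; [exists 1|exists (-1)]; rewrite ?normrN normr1.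
Qed.

(** * Points peeled off a finite set *)

Lemma stadium_side {R : realType} (q : plane R) : `|q.2| <= `|q.1| ->
  stadium q * (2 * `|q.1|) = q.1 ^+ 2 + q.2 ^+ 2.
Proof.
move=> q21; have [q1|q1] := eqVneq q.1 0.
  move: q21; rewrite q1 normr0 normr_le0 => /eqP ->; lra.
rewrite /stadium; case: ifPn => [q12|_]; last by rewrite divfK// mulf_neq0// normr_eq0.
rewrite -[q.2 ^+ 2]real_normK ?num_real// (_ : `|q.2| = `|q.1|).
  by rewrite real_normK ?num_real// mulrCA -expr2 real_normK ?num_real//; lra.
by apply/eqP; rewrite eq_le q21.
Qed.

(* The conclusion pairs [v] with the gradient of [stadium] at [q], where [s] is
   the sign of [q.1] and [t] the slope [q.2 / |q.1|]. *)
Lemma stadium_subgrad {R : realType} (q v : plane R) (s t : R) :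
  `|s| = 1 -> `|t| <= 1 -> 0 <= s * q.1 -> q.2 = t * (s * q.1) ->
  stadium (q - v) <= stadium q -> 0 <= (1 - t ^+ 2) / 2 * (s * v.1) + t * v.2.
Proof.
move=> s1 t1 sq q2 le.
have aq : `|q.1| = s * q.1 by rewrite -[RHS]ger0_norm// normrM s1 mul1r.
have tp := half_subr_sqr_ge0 t t1.
have h1 : stadium q <= stadium_lin t q.
  have [q1|q1] := eqVneq q.1 0.
    have -> : q = 0 by rewrite [q]surjective_pairing q2 q1 !mulr0.
    by rewrite stadium0 /stadium_lin/= normr0 !mulr0 addr0.
  have q10 : 0 < 2 * `|q.1| by rewrite mulr_gt0// normr_gt0.
  rewrite -(ler_pM2r q10) stadium_side.
    rewrite /stadium_lin q2 -aq -[q.1 ^+ 2]real_normK ?num_real//; lra.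
  by rewrite q2 -aq normrM normr_id ler_piMl.
have := le_trans (le_trans (stadium_ge t (q - v) t1) le) h1.
have : s * (q.1 - v.1) <= `|q.1 - v.1|.
  by apply: le_trans (ler_norm _) _; rewrite normrM s1 mul1r.
move=> /(ler_wpM2l tp); rewrite /stadium_lin/= aq; lra.
Qed.

(** The point [b] is in the open horizontal cone of direction [e] with apex [x]. Strictness makes
    the property stable under small moves of [x]. *)
Definition side {R : realType} (e : R) (A : set (plane R)) (x : plane R) :=
  exists2 b, A b & `|b.2 - x.2| < e * (b.1 - x.1).

(* For [e = 1] (resp. [-1]), one or two points of [A] showing that no line through
   [x] of slope in [-1, 1] lies above (resp. below) [A]. *)
Definition capped {R : realType} (e : R) (A : set (plane R)) (x : plane R) :=
  (exists2 b, A b & `|b.1 - x.1| < e * (b.2 - x.2)) \/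
  (exists b b', [/\ A b, A b', b'.1 < x.1, x.1 < b.1
     & e * ((b.2 - x.2) * (b'.1 - x.1)) < e * ((b'.2 - x.2) * (b.1 - x.1))]).

(** A move [v] that takes [x] no farther from any point of [A] has nonnegative product with a
    gradient of [stadium] at each [a - x]. A witness in the vertical cone has gradient (0, e); for
    two witnesses on either side of [x], a nonnegative combination of the gradients is a positive
    multiple of (0, e). *)
Lemma capped_dir {R : realType} (e : R) (A : set (plane R)) (x v : plane R) :
  `|e| = 1 -> capped e A x ->
  (forall a, A a -> stadium (a - (x + v)) <= stadium (a - x)) -> 0 <= e * v.2.
Proof.
move=> e1 + Av.
have e2 := sqr_norm1 e e1.
have single b : A b -> `|b.1 - x.1| < e * (b.2 - x.2) -> 0 <= e * v.2.
  move=> /Av; rewrite opprD addrA => le lt.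
  have eb : `|(b - x).2| = e * (b.2 - x.2).
    by rewrite /= -[RHS]ger0_norm ?normrM ?e1 ?mul1r// (le_trans _ (ltW lt)).
  have := le_trans (stadium_ge2 _) le; rewrite (stadium_top (b - x)); last first.
    by rewrite eb/= ltW.
  rewrite eb; have := ler_norm (e * (b - x - v).2); rewrite normrM e1 mul1r/=; lra.
case=> [[b Ab lt]|[b [b' [Ab Ab' xb' xb lt]]]]; first exact: (single b).
set q := b - x; set q' := b' - x.
have q1 : 0 < q.1 by rewrite subr_gt0.
have q1' : q'.1 < 0 by rewrite subr_lt0.
have lt' : e * (q.2 * q'.1) < e * (q'.2 * q.1) by [].
have [h|h] := ltP `|q.1| (e * q.2); first exact: (single b).
have [h'|h'] := ltP `|q'.1| (e * q'.2); first exact: (single b').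
move: h h'; rewrite gtr0_norm// ltr0_norm// => h h'.
pose T := e * (q.2 / q.1); pose T' := e * (q'.2 / q'.1).
have Tq : T * q.1 = e * q.2 by rewrite /T -mulrA divfK// lt0r_neq0.
have Tq' : T' * q'.1 = e * q'.2 by rewrite /T' -mulrA divfK// ltr0_neq0.
have TT : T' < T.
  rewrite -subr_gt0 -(nmulr_llt0 _ q1') -(pmulr_llt0 _ q1).
  have -> : (T - T') * q'.1 * q.1 = (T * q.1) * q'.1 - (T' * q'.1) * q.1 by ring.
  by rewrite Tq Tq' subr_lt0 -!mulrA.
have T1 : T <= 1 by rewrite -(ler_pM2r q1) Tq mul1r.
have T'1 : -1 <= T' by rewrite -(ler_nM2r q1') Tq' mulN1r.
have tT : `|e * T| <= 1 by rewrite normrM e1 mul1r ler_norml T1 (le_trans T'1)// ltW.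
have tT' : `|- (e * T')| <= 1
  by rewrite normrN normrM e1 mul1r ler_norml T'1/= (le_trans (ltW TT)).
have := @stadium_subgrad _ q v 1 (e * T) (normr1 _) tT.
rewrite !mul1r -[e * T * q.1]mulrA Tq mulrA e2 mul1r => /(_ (ltW q1) erefl).
have := Av _ Ab; rewrite opprD addrA => le /(_ le) {le}.
have := @stadium_subgrad _ q' v (-1) (- (e * T')) (normrN1 _) tT'.
rewrite !mulN1r mulrNN -[e * T' * _]mulrA Tq' mulrA e2 mul1r oppr_ge0 => /(_ (ltW q1') erefl).
have := Av _ Ab'; rewrite opprD addrA => le /(_ le) {le}.
rewrite sqrrN (exprMn 2 e T) (exprMn 2 e T') [e ^+ 2]expr2 e2 !mul1r => i' i.
set V := e * v.2.
have j : 0 <= (1 - T ^+ 2) / 2 * v.1 + T * V by move: i; rewrite /V; lra.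
have j' : 0 <= - ((1 - T' ^+ 2) / 2 * v.1) - T' * V.
  by move: i'; rewrite /V; lra.
have a0 : 0 <= (1 - T ^+ 2) / 2 by nra.
have b0 : 0 <= (1 - T' ^+ 2) / 2 by nra.
(* These weights cancel [v.1]. The factor left in front of [V] is positive unless [T = 1] and
   [T' = -1], and then [j] alone gives the sign. *)
have := addr_ge0 (mulr_ge0 b0 j) (mulr_ge0 a0 j').
have -> : (1 - T' ^+ 2) / 2 * ((1 - T ^+ 2) / 2 * v.1 + T * V) +
  (1 - T ^+ 2) / 2 * (- ((1 - T' ^+ 2) / 2 * v.1) - T' * V) =
  ((T - T') * (1 + T * T') / 2) * V by lra.
have : 0 <= 1 + T * T' by nra.
rewrite le_eqVlt => /orP[/eqP TT1|TT1]; last first.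
  by rewrite pmulr_rge0// divr_gt0// mulr_gt0// subr_gt0.
have T_1 : T = 1 by nra.
by move: j; rewrite T_1; lra.
Qed.

Lemma side_dir {R : realType} (e : R) (A : set (plane R)) (x v : plane R) :
  `|e| = 1 -> side e A x -> v.2 = 0 ->
  (forall a, A a -> stadium (a - (x + v)) <= stadium (a - x)) -> 0 <= e * v.1.
Proof.
move=> e1 [b Ab lt] v2 /(_ _ Ab); rewrite opprD addrA => le.
have q0 : 0 < e * (b - x).1 by apply: le_lt_trans lt.
have t1 : `|(b - x).2 / (e * (b - x).1)| < 1.
  by rewrite normrM normfV ltr_pdivrMr ?normr_gt0 ?lt0r_neq0// mul1r [X in _ < X]gtr0_norm.
have := @stadium_subgrad _ (b - x) v e _ e1 (ltW t1) (ltW q0).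
rewrite divfK ?lt0r_neq0// => /(_ erefl le).
rewrite v2 mulr0 addr0 pmulr_rge0// divr_gt0// subr_gt0.
by rewrite -[_ ^+ 2]real_normK ?num_real// expr_lt1.
Qed.

(** A competitor [x + v] at least as close to all of [A] must be [x]: the two caps force [v.2 = 0],
    after which the two sides force [v.1 = 0]. *)
Lemma pareto_witness {R : realType} (A : set (plane R)) (x : plane R) :
  (forall e : R, `|e| = 1 -> side e A x /\ capped e A x) -> pareto stadium A x.
Proof.
move=> w y yx; apply: contrapT => nA; move/eqP: yx; apply.
pose v := y - x; have yE : y = x + v by rewrite /v addrCA subrr addr0.
have Av a : A a -> stadium (a - (x + v)) <= stadium (a - x).
  by rewrite -yE => Aa; rewrite leNgt; apply/negP => lt; apply: nA; exists a.
have [[s1 c1] [s2 c2]] := (w 1 (normr1 _), w (-1) (normrN1 _)).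
have v2 : v.2 = 0.
  have := capped_dir _ _ _ _ (normr1 _) c1 Av.
  have := capped_dir _ _ _ _ (normrN1 _) c2 Av; lra.
have v1 : v.1 = 0.
  have := side_dir _ _ _ _ (normr1 _) s1 v2 Av.
  have := side_dir _ _ _ _ (normrN1 _) s2 v2 Av; lra.
by rewrite yE [v]surjective_pairing v1 v2 addr0.
Qed.

Lemma near_lt {R : realType} (f g : plane R -> R) (a : plane R) :
  {for a, continuous f} -> {for a, continuous g} -> f a < g a ->
  \forall x \near a, f x < g x.
Proof.
move=> cf cg fg.
have : (g \- f) x @[x --> a] --> g a - f a by exact: cvgB.
move=> /cvgr_gt /(_ 0); rewrite subr_gt0 => /(_ fg).
by apply: filterS => x; rewrite /= subr_gt0.
Qed.

Lemma side_near {R : realType} (e : R) (A : set (plane R)) (a : plane R) :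
  side e A a -> \forall x \near a, side e A x.
Proof.
move=> [b Ab lt].
have : \forall x \near a, `|b.2 - x.2| < e * (b.1 - x.1).
  apply: near_lt lt.
    by apply: cvg_norm; apply: cvgB; [exact: cvg_cst|exact: cvg_snd].
  by apply: cvgMr; apply: cvgB; [exact: cvg_cst|exact: cvg_fst].
by apply: filterS => x lx; exists b.
Qed.

Lemma capped_near {R : realType} (e : R) (A : set (plane R)) (a : plane R) :
  capped e A a -> \forall x \near a, capped e A x.
Proof.
have c1 (c : R) : (c - x.1) @[x --> a] --> c - a.1.
  by apply: cvgB; [exact: cvg_cst|exact: cvg_fst].
have c2 (c : R) : (c - x.2) @[x --> a] --> c - a.2.
  by apply: cvgB; [exact: cvg_cst|exact: cvg_snd].
case=> [[b Ab lt]|[b [b' [Ab Ab' xb' xb lt]]]].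
  have : \forall x \near a, `|b.1 - x.1| < e * (b.2 - x.2).
    apply: near_lt lt; first by apply: cvg_norm; exact: c1.
    by apply: cvgMr; exact: c2.
  by apply: filterS => x lx; left; exists b.
have n1 : \forall x \near a, b'.1 < x.1.
  by apply: (near_lt (fun=> b'.1) (fun x : plane R => x.1)) xb';
    [exact: cvg_cst|exact: cvg_fst].
have n2 : \forall x \near a, x.1 < b.1.
  by apply: (near_lt (fun x : plane R => x.1) (fun=> b.1)) xb; [exact: cvg_fst|exact: cvg_cst].
have n3 : \forall x \near a, e * ((b.2 - x.2) * (b'.1 - x.1)) <
                             e * ((b'.2 - x.2) * (b.1 - x.1)).
  apply: (near_lt (fun x : plane R => e * ((b.2 - x.2) * (b'.1 - x.1)))
    (fun x : plane R => e * ((b'.2 - x.2) * (b.1 - x.1)))) lt; apply: cvgMr; apply: cvgM;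
      by [exact: c1|exact: c2].
near=> x; right; exists b, b'; split => //; near: x; by [exact: n1|exact: n2|exact: n3].
Unshelve. all: by end_near. Qed.

Definition supported {R : realType} (e : R) (A : set (plane R)) (a : plane R) (t : R) :=
  forall b, A b -> e * (b.2 - a.2) <= t * (b.1 - a.1).

(** The slope is the supremum of -1 and of the slopes from [a] to points on its right. A point on
    the left above that line would form a cap with some point on the right. *)
Lemma capped_or_supported {R : realType} (e : R) (A : set (plane R)) (a : plane R) :
  ~ capped e A a -> exists2 t : R, `|t| <= 1 & supported e A a t.
Proof.
move=> nc.
have single b : A b -> e * (b.2 - a.2) <= `|b.1 - a.1|.
  by move=> Ab; rewrite leNgt; apply/negP => lt; apply: nc; left; exists b.
pose S : set R := [set -1] `|` [set e * (b.2 - a.2) /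
  (b.1 - a.1) | b in [set b | A b /\ a.1 < b.1]].
have Sle1 : ubound S 1.
  move=> _ [->|[b [Ab ab] <-]]; first by rewrite (@le_trans _ _ 0).
  have ab0 : 0 < b.1 - a.1 by rewrite subr_gt0.
  by rewrite ler_pdivrMr// mul1r -(gtr0_norm ab0) single.
have S1 : S (-1) by left.
have hS : has_sup S by split; [exists (-1)|exists 1].
have s1 : sup S <= 1 by apply: ge_sup => //; exists (-1).
have sm1 : -1 <= sup S by apply: ub_le_sup => //; exact: hS.2.
exists (sup S); first by rewrite ler_norml sm1.
move=> b Ab; have [ab|ab|ab] := ltgtP a.1 b.1.
- rewrite -ler_pdivrMr ?subr_gt0//; apply: ub_le_sup; first exact: hS.2.
  by right; exists b.
- have ab0 : b.1 - a.1 < 0 by rewrite subr_lt0.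
  rewrite -ler_ndivlMr//; apply: ge_sup; first by exists (-1).
  move=> _ [->|[c [Ac ac] <-]].
    by rewrite ler_ndivlMr// mulN1r -(ltr0_norm ab0) single.
  have ac0 : 0 < c.1 - a.1 by rewrite subr_gt0.
  rewrite ler_ndivlMr// mulrAC ler_pdivlMr// leNgt; apply/negP => lt.
  apply: nc; right; exists c, b; split=> //.
  by rewrite !mulrA.
- by have := single _ Ab; rewrite ab subrr normr0 mulr0.
Qed.

(** All witnesses are strict inequalities, so if none were missing at [a] they would persist nearby
    and put a neighbourhood of [a] in the hull. *)
Lemma peeled {R : realType} (A : set (plane R)) (a : plane R) :
  ~ interior (pareto stadium A) a ->
  exists e : R, `|e| = 1 /\
    (~ side e A a \/ exists2 t : R, `|t| <= 1 & supported e A a t).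
Proof.
move=> na; apply: contrapT => h; apply: na.
have h' (e : R) : `|e| = 1 -> side e A a /\ capped e A a.
  move=> e1; split; apply: contrapT => n; apply: h; exists e; split=> //.
    by left.
  by right; exact: capped_or_supported.
have [[s1 c1] [s2 c2]] := (h' 1 (normr1 _), h' (-1) (normrN1 _)).
rewrite /interior/=; near=> x; apply: pareto_witness => e e1.
have [->|->] := normr_eq1 e e1.
- by split; near: x; [exact: side_near|exact: capped_near].
- by split; near: x; [exact: side_near|exact: capped_near].
Unshelve. all: by end_near. Qed.

(** * Layers of a finite set and the height *)

Definition remaining {R : realType} (A : set (plane R)) (k : nat) : set (plane R) :=
  if k is j.+1 then A `&` interior (peel stadium A j) else A.

Lemma peelE {R : realType} (A : set (plane R)) k :
  peel stadium A k = pareto stadium (remaining A k).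
Proof. by case: k. Qed.

Lemma remaining_sub {R : realType} (A : set (plane R)) k : remaining A k `<=` A.
Proof. by case: k => [|k] //= x []. Qed.

Lemma remainingS {R : realType} (A : set (plane R)) k :
  remaining A k.+1 `<=` remaining A k.
Proof.
elim: k => [|k IH] x; first by case.
move=> [Ax kx]; split=> //; apply: interiorS kx.
by rewrite !peelE; exact: pareto_mono.
Qed.

Lemma peel_decr {R : realType} (A : set (plane R)) j k : (j <= k)%N ->
  peel stadium A k `<=` peel stadium A j.
Proof.
move=> /subnK <-; elim: (k - j)%N => [|i IH] //.
apply: subset_trans IH; rewrite addSn !peelE.
exact/pareto_mono/remainingS.
Qed.

(** A highest remaining point is discarded, since by [pareto_le2] the hull does not rise above
    it. *)
Lemma remaining_strict {R : realType} (A : set (plane R)) k : finite_set A ->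
  remaining A k !=set0 ->
  exists2 b, remaining A k b & ~ remaining A k.+1 b.
Proof.
move=> fA [a0 ka0].
have fk : finite_set (remaining A k) := sub_finite_set (remaining_sub _ _) fA.
pose s := enum_fset (fset_set (remaining A k)).
have sP x : (x \in s) = (x \in remaining A k) by rewrite in_fset_set.
have [b bs bmax] : exists2 b, b \in s & forall x, x \in s -> x.2 <= b.2.
  have : a0 \in s by rewrite sP; exact: mem_set.
  elim: (s) a0 {ka0} => // c r IH a0 _.
  case: r IH => [|d r] IH.
    by exists c; rewrite ?inE// => x; rewrite inE => /eqP ->.
  have [b br bmax] := IH d (mem_head _ _).
  have [bc|cb] := leP b.2 c.2.
    exists c; rewrite ?mem_head// => x; rewrite inE => /orP[/eqP ->//|xr].
    exact: le_trans (bmax _ xr) bc.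
  exists b; first by rewrite inE br orbT.
  by move=> x; rewrite inE => /orP[/eqP ->|/bmax//]; exact: ltW.
exists b; first by move: bs; rewrite sP => /set_mem.
move=> [_]; rewrite peelE => /nbhs_ballP[e /= e0 h].
have e2 : 0 < e / 2 by rewrite divr_gt0.
have /h : ball b e (b.1, b.2 + e / 2).
  split; rewrite -ball_normE /ball_/=; first by rewrite subrr normr0.
  by rewrite opprD addrA subrr sub0r normrN gtr0_norm//; lra.
have /pareto_le2 : remaining A k `<=` [set x | x.2 <= b.2].
  by move=> x kx /=; apply: bmax; rewrite sP; exact: mem_set.
by move=> /[apply]/=; lra.
Qed.

Lemma peel_exhausted {R : realType} (A : set (plane R)) : finite_set A ->
  exists k, peel stadium A k = set0.
Proof.
move=> fA.
suff [k k0] : exists k, remaining A k = set0.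
  by exists k; rewrite peelE k0 pareto_set0.
have fk k : finite_set (remaining A k) := sub_finite_set (remaining_sub _ _) fA.
apply: contrapT => nk.
have H k : (#|` fset_set (remaining A k)| + k <= #|` fset_set A|)%N.
  elim: k => [|k]; first by rewrite addn0.
  apply: leq_trans; rewrite addnS -addSn leq_add2r.
  have [|b kb nb] := @remaining_strict _ A k fA.
    by apply/set0P/eqP => k0; apply: nk; exists k.
  apply: fproper_ltn_card; apply/andP; split.
    by rewrite -fset_set_sub//; exact: remainingS.
  apply/negP; rewrite -fset_set_sub// => /(_ _ kb); exact: nb.
have := H (#|` fset_set A|).+1; lia.
Qed.

(** The peels decrease, so the indicators are 1 before the first failure [k] and 0 from there on,
    and the series is eventually constant. *)
Lemma height_stadium {R : realType} (A : set (plane R)) (x : plane R) :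
  finite_set A -> exists k : nat, height stadium A x = k%:R /\
    (forall j, (j < k)%N -> interior (peel stadium A j) x) /\
    ~ interior (peel stadium A k) x.
Proof.
move=> fA.
have ex : exists k, `[< ~ interior (peel stadium A k) x >].
  by have [k k0] := peel_exhausted _ fA; exists k; apply/asboolP; rewrite k0 interior0.
case: (ex_minnP ex) => k /asboolP kx kmin.
have lt j : (j < k)%N -> interior (peel stadium A j) x.
  by move=> jk; apply: contrapT => /asboolP/kmin; rewrite leqNgt jk.
exists k; split=> //.
rewrite /height; apply/cvg_lim => //; apply: cvg_near_cst.
exists k => // n /= kn; rewrite /series/= (big_cat_nat _ kn)//=.
rewrite [X in _ + X]big_nat_cond [X in _ + X]big1 ?addr0; last first.
  move=> j /andP[/andP[kj _] _]; rewrite indicE; case: (boolP (_ \in _)) => // /set_mem.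
  by move=> /(interiorS (peel_decr _ _ _ kj)).
rewrite big_nat_cond (eq_bigr (fun=> 1)).
  by rewrite -big_nat_cond sumr_const_nat subn0.
by move=> j /andP[/andP[_ jk] _]; rewrite indicE mem_set//; exact: lt.
Qed.

Lemma height_off_square {R : realType} (A : set (plane R)) (x : plane R) :
  finite_set A -> A `<=` square -> ~ square x -> height stadium A x = 0.
Proof.
move=> fA AU xU; have [[|k] [-> [lt _]]] := height_stadium A x fA => //.
exfalso; apply: xU; have := lt 0%N isT; rewrite -interior_csquare.
apply: interiorS; rewrite -pareto_csquare; apply: pareto_mono.
by rewrite -closure_square; apply: subset_trans AU (@subset_closure _ _).
Qed.

(** * Monotone chains and staircases *)

Definition ncard {T : choiceType} (S : set T) : nat := #|` fset_set S|.

Lemma ncard_sub {T : choiceType} (S S' : set T) : finite_set S' -> S `<=` S' ->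
  (ncard S <= ncard S')%N.
Proof.
move=> fS' SS'; apply: fsubset_leq_card; rewrite -fset_set_sub//.
exact: sub_finite_set fS'.
Qed.

Lemma ncardU {T : choiceType} (S S' : set T) : finite_set S -> finite_set S' ->
  (ncard (S `|` S') <= ncard S + ncard S')%N.
Proof. by move=> fS fS'; rewrite /ncard fset_setU// cardfsU leq_subr. Qed.

Lemma ncard_bigsetU {T : choiceType} (I : Type) (r : seq I) (S : I -> set T) :
  (forall i, finite_set (S i)) ->
  (ncard (\big[setU/set0]_(i <- r) S i) <= \sum_(i <- r) ncard (S i))%N.
Proof.
move=> fS; elim: r => [|i r IH]; first by rewrite !big_nil /ncard fset_set0 cardfs0.
rewrite !big_cons; apply: leq_trans (ncardU _ _ _ _) _ => //.
  by elim: (r) => [|j q IHq]; rewrite ?big_nil// big_cons finite_setU.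
by rewrite leq_add2l.
Qed.

Lemma counting_ncard {R : realType} {T : choiceType} (S : set T) : finite_set S ->
  counting S = (ncard S)%:R%:E :> \bar R.
Proof. by move=> fS; rewrite /counting asboolT. Qed.

Section Staircase.
Context {T : choiceType} (S : set T) (col row : T -> nat).
Hypothesis fS : finite_set S.
Hypothesis mono : forall a b, S a -> S b -> (col a < col b)%N -> (row a <= row b)%N.

(** The highest row met before column [i]; the rows met in column [i] itself then lie between
    [stair i] and [stair i.+1]. *)
Definition stair (i : nat) : nat := \max_(a <- fset_set S | (col a < i)%N) row a.

Lemma mem_fS a : (a \in fset_set S) -> S a.
Proof. by rewrite in_fset_set// => /set_mem. Qed.

Lemma stair_homo i j : (i <= j)%N -> (stair i <= stair j)%N.
Proof.
move=> ij; apply/bigmax_leqP_seq => a aS ai.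
by apply: leq_bigmax_seq => //; exact: leq_trans ij.
Qed.

Lemma stair_le a : S a -> (stair (col a) <= row a)%N.
Proof.
by move=> Sa; apply/bigmax_leqP_seq => b /mem_fS bS ba; exact: mono.
Qed.

Lemma stair_ge a : S a -> (row a <= stair (col a).+1)%N.
Proof.
by move=> Sa; apply: leq_bigmax_seq => //; rewrite in_fset_set//; exact: mem_set.
Qed.

Lemma stair_bound n i : (forall a, S a -> (row a <= n)%N) -> (stair i <= n)%N.
Proof. by move=> rn; apply/bigmax_leqP_seq => b /mem_fS bS _; exact: rn. Qed.

End Staircase.

(** Telescoping: each column contributes its jump plus one cell. *)
Lemma stair_area (F : nat -> nat) (G n : nat) : (forall i, (F i <= F i.+1)%N) ->
  (F G <= n)%N -> (\sum_(i < G) ((F i.+1).+1 - F i) <= n + G)%N.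
Proof.
move=> Fm; have : (\sum_(i < G) ((F i.+1).+1 - F i) <= F G + G)%N.
  elim: G => [|G IH]; first by rewrite big_ord0.
  rewrite big_ord_recr/=; apply: leq_trans (leq_add IH (leqnn _)) _.
  by have := Fm G; move: (F G) (F G.+1) => p q; lia.
by move=> h FGn; apply: leq_trans h _; rewrite leq_add2r.
Qed.

Section Windows.
Context {R : realType}.
Implicit Types (v w : plane R -> R) (A S : set (plane R)).

Definition cell v w (v0 w0 h1 h2 : R) (i j : nat) : set (plane R) :=
  [set x | v0 + i%:R * h1 <= v x < v0 + i.+1%:R * h1 /\
           w0 + j%:R * h2 <= w x < w0 + j.+1%:R * h2].

(* Counting points of a chain for the order (v, w): the cells of a G x G grid that
   it meets lie on a staircase of at most 2 G cells, and there are at most 4 ^ G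
   staircases. *)
Definition stairs v w (v0 w0 h1 h2 : R) (G : nat) (F : nat -> nat) : set (plane R) :=
  \big[setU/set0]_(i < G) \big[setU/set0]_(F i <= j < (F i.+1).+1)
    cell v w v0 w0 h1 h2 i j.

(** Quantifying over staircases rather than chains leaves finitely many fixed sets, to which a union
    bound applies; a chain selects its own staircase afterwards, in [chain_bound]. *)
Definition thin v w (v0 w0 h1 h2 : R) (G : nat) A : Prop :=
  forall t : G.+1.-tuple 'I_G, sorted leq (map val t) ->
    (counting (A `&` stairs v w v0 w0 h1 h2 G (nth 0%N (map val t))) < (6 * G)%:R%:E
      :> \bar R)%E.

Lemma truncn_grid (y y0 h : R) (G : nat) : 0 < h -> y0 <= y < y0 + G%:R * h ->
  exists i, [/\ (i < G)%N, y0 + i%:R * h <= y & y < y0 + i.+1%:R * h].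
Proof.
move=> h0 /andP[y0y yG]; exists (Num.truncn ((y - y0) / h)).
have p : 0 <= (y - y0) / h by rewrite divr_ge0 ?(ltW h0)// subr_ge0.
have /andP[t1 t2] := truncn_itv p.
rewrite -(ltr_nat R) (le_lt_trans t1); last by rewrite ltr_pdivrMr// ltrBlDl.
by split=> //; rewrite -?ltrBlDl -?lerBrDl -?ltr_pdivrMr -?ler_pdivlMr.
Qed.

Lemma chain_bound v w (v0 w0 h1 h2 : R) (G : nat) A S :
  (0 < G)%N -> 0 < h1 -> 0 < h2 -> finite_set A -> thin v w v0 w0 h1 h2 G A ->
  S `<=` A ->
  (forall a, S a -> v0 <= v a < v0 + G%:R * h1 /\ w0 <= w a < w0 + G%:R * h2) ->
  (forall a b, S a -> S b -> v a < v b -> w a <= w b) ->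
  (ncard S < 6 * G)%N.
Proof.
move=> G0 h10 h20 fA th SA Sw mono.
have fS : finite_set S := sub_finite_set SA fA.
have /choice[cr crP] : forall a, exists ij : nat * nat, S a ->
    [/\ (ij.1 < G)%N, (ij.2 < G)%N & cell v w v0 w0 h1 h2 ij.1 ij.2 a].
  move=> a; have [Sa|nSa] := pselect (S a); last by exists (0, 0)%N.
  have [/truncn_grid i1 /truncn_grid j1] := Sw a Sa.
  have [[i [iG i2 i3]] [j [jG j2 j3]]] := (i1 h10, j1 h20).
  by exists (i, j) => _; split=> //; rewrite /cell/= i2 i3 j2 j3.
pose col a := (cr a).1; pose row a := (cr a).2.
have crmono a b : S a -> S b -> (col a < col b)%N -> (row a <= row b)%N.
  move=> Sa Sb ab; have [_ _ [/andP[a1 a2] /andP[a3 a4]]] := crP a Sa.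
  have [_ _ [/andP[b1 b2] /andP[b3 b4]]] := crP b Sb.
  rewrite -ltnS -(ltr_nat R) -(ltr_pM2r h20) -(ltrD2l w0).
  apply: le_lt_trans a3 (le_lt_trans _ b4); apply: mono => //.
  apply: lt_le_trans a2 (le_trans _ b1).
  by rewrite lerD2l ler_pM2r// ler_nat.
have rowG a : S a -> (row a <= G.-1)%N by move=> /crP[_ h _]; rewrite -ltnS prednK.
pose F := stair S col row.
have FG i : (F i < G)%N by rewrite -[X in (_ < X)%N]prednK// ltnS; exact: stair_bound.
pose t : G.+1.-tuple 'I_G := [tuple Ordinal (FG i) | i < G.+1].
have tE i : (i <= G)%N -> nth 0%N (map val t) i = F i.
  move=> iG; rewrite -map_comp (nth_map ord0) ?size_enum_ord//=.
  by rewrite nth_enum_ord.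
have st : sorted leq (map val t).
  apply/(sortedP 0%N) => i; rewrite size_map size_tuple ltnS => iG.
  by rewrite !tE ?(ltnW iG)//; apply: stair_homo.
have := th t st.
have fst : finite_set (A `&` stairs v w v0 w0 h1 h2 G (nth 0%N (map val t))).
  exact: finite_setIl.
rewrite counting_ncard// lte_fin ltr_nat; apply: leq_ltn_trans.
apply: ncard_sub => // a Sa; split; first exact: SA.
have [c1 c2 c3] := crP a Sa.
pose f := nth 0%N (map val t).
rewrite /stairs -(bigcup_mkord G (fun i => \big[setU/set0]_(f i <= j < (f i.+1).+1)
  cell v w v0 w0 h1 h2 i j)); exists (col a) => //=.
rewrite -bigcup_seq; exists (row a) => //=.
rewrite mem_index_iota /f !tE ?(ltnW c1)// ltnS.
by rewrite stair_le ?stair_ge.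
Qed.

(** Values of oscillation at most [eta] fit in a window of length [2 * eta] that starts at the
    multiple of [eta] just below their infimum, hence [k.+2]. This replaces a window depending on
    [S] by one from a fixed finite list. *)
Lemma window_select S (f : plane R -> R) (eta : R) (K : nat) : 0 < eta ->
  S !=set0 -> (forall a, S a -> 0 <= f a < K%:R * eta) ->
  (forall a b, S a -> S b -> f a <= f b + eta) ->
  exists2 k : nat, (k < K)%N &
    forall a, S a -> k%:R * eta <= f a < k.+2%:R * eta.
Proof.
move=> e0 [c Sc] fK fe.
have lbS : lbound (f @` S) 0 by move=> _ [a /fK/andP[+ _] <-].
have ne : f @` S !=set0 by exists (f c), c.
have infP a : S a -> inf (f @` S) <= f a.
  by move=> Sa; apply: ge_inf; [exists 0|exists a].
have [k [kK k1 k2]] : exists k, [/\ (k < K)%N, 0 + k%:R * eta <= inf (f @` S) &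
    inf (f @` S) < 0 + k.+1%:R * eta].
  apply: truncn_grid => //; rewrite lb_le_inf//= add0r.
  by apply: le_lt_trans (infP c Sc) _; case/andP: (fK c Sc).
rewrite !add0r in k1 k2; exists k => // a Sa.
rewrite (le_trans k1 (infP a Sa))/=.
have : f a - eta <= inf (f @` S).
  by apply: lb_le_inf => // _ [b Sb <-]; rewrite lerBlDr; exact: fe.
rewrite -[k.+2]addn1 natrD mulrDl mul1r; lra.
Qed.

End Windows.

Definition strip {R : realType} (D : nat) : set (plane R) :=
  [set x | - 2^-1 <= x.1 < 2^-1 /\ 1 - D%:R^-1 < x.2 < 1].

(** In the coordinates [x.2 + x.1] and [x.2 - x.1] a 1-Lipschitz graph over [x.2] is a monotone
    chain. Over a strip of height [1 / D] both oscillate by at most [2 / D], and for [2 <= D] they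
    stay in [0, 2[, so [D] starting points suffice for each. *)
Definition cone_thin {R : realType} (D G : nat) (A : set (plane R)) : Prop :=
  forall i j, (i < D)%N -> (j < D)%N ->
  thin (fun x => x.2 + x.1) (fun x => x.2 - x.1)
    (i%:R * (2 / D%:R)) (j%:R * (2 / D%:R)) (4 / D%:R / G%:R) (4 / D%:R / G%:R) G A.

Lemma lipschitz_chain_bound {R : realType} (D G : nat) (A S : set (plane R)) :
  (2 <= D)%N -> (0 < G)%N -> finite_set A -> S `<=` A `&` strip D -> cone_thin D G A ->
  (forall a b, S a -> S b -> `|a.1 - b.1| <= `|a.2 - b.2|) ->
  (ncard S <= 6 * G)%N.
Proof.
move=> D2 G0 fA SA th lip.
have [->|Sn0] := eqVneq S set0; first by rewrite /ncard fset_set0 cardfs0.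
have {}Sn0 : S !=set0 by apply/set0P.
have D0 : 0 < D%:R :> R by rewrite ltr0n (leq_trans _ D2).
have D2R : 2 <= D%:R :> R by rewrite ler_nat.
pose del : R := D%:R^-1; have del0 : 0 < del by rewrite invr_gt0.
have Ddel : D%:R * del = 1 by rewrite mulfV// lt0r_neq0.
have del2 : del <= 2^-1 by rewrite lef_pV2// posrE.
have W a : S a -> [/\ - 2^-1 <= a.1, a.1 < 2^-1, 1 - del < a.2 & a.2 < 1].
  by move=> /SA[_ [/andP[? ?] /andP[? ?]]].
have eta0 : 0 < 2 / D%:R :> R by rewrite divr_gt0.
have De : D%:R * (2 / D%:R) = 2 :> R by rewrite mulrCA mulfV ?mulr1// lt0r_neq0.
have lipD a b : S a -> S b -> a.2 - b.2 < del /\ `|a.1 - b.1| < del.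
  move=> Sa Sb; have [_ _ a3 a4] := W a Sa; have [_ _ b3 b4] := W b Sb.
  split; first lra.
  by apply: le_lt_trans (lip a b Sa Sb) _; rewrite ltr_norml; lra.
have v1 a : S a -> 0 <= a.2 + a.1 < D%:R * (2 / D%:R) by move=> /W[*]; rewrite De; lra.
have v2 a b : S a -> S b -> a.2 + a.1 <= b.2 + b.1 + 2 / D%:R.
  by move=> Sa Sb; have [h1] := lipD a b Sa Sb; rewrite ltr_norml -/del; lra.
have w1 a : S a -> 0 <= a.2 - a.1 < D%:R * (2 / D%:R) by move=> /W[*]; rewrite De; lra.
have w2 a b : S a -> S b -> a.2 - a.1 <= b.2 - b.1 + 2 / D%:R.
  by move=> Sa Sb; have [h1] := lipD a b Sa Sb; rewrite ltr_norml -/del; lra.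
have [i iD iP] := window_select _ (fun x => x.2 + x.1) _ _ eta0 Sn0 v1 v2.
have [j jD jP] := window_select _ (fun x => x.2 - x.1) _ _ eta0 Sn0 w1 w2.
have G0R : 0 < G%:R :> R by rewrite ltr0n.
have h0 : 0 < 4 / D%:R / G%:R :> R by rewrite !divr_gt0.
have hG (k : nat) : k%:R * (2 / D%:R) + G%:R * (4 / D%:R / G%:R) = k.+2%:R * (2 / D%:R) :> R.
  rewrite -[k.+2]addn2 natrD; field; rewrite !lt0r_neq0//.
apply/ltnW/(chain_bound _ _ _ _ _ _ _ _ _ G0 h0 h0 fA (th i j iD jD)).
- by move=> a /SA[].
- by move=> a Sa; rewrite !hG; split; [exact: iP|exact: jP].
- move=> a b Sa Sb ab.
  have h : `|b.1 - a.1| <= `|b.2 - a.2| by exact: lip.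
  have [c|c] := leP 0 (b.2 - a.2).
    by move: h; rewrite (ger0_norm c) ler_norml; lra.
  by move: h; rewrite (ltr0_norm c) ler_norml; lra.
Qed.

(* The windows in which a convex chain with slopes in [-1, 1] becomes monotone: the
   strip is cut into [M] columns, the slopes into buckets of width [2 / M], and in
   each column [e * x.2] is sheared by the least slope of a bucket. *)
Definition shear_thin {R : realType} (M G : nat) (e : R) (A : set (plane R)) : Prop :=
  forall i j k, (i < M)%N -> (j < M.+1)%N -> (k < 2 * M ^ 2)%N ->
  thin fst (fun x => e * x.2 - (1 - j.+1%:R * (2 / M%:R)) * x.1)
    (- 2^-1 + i%:R / M%:R) (- 2 + k%:R * (2 / M%:R ^+ 2))
    (M%:R^-1 / G%:R) (4 / M%:R ^+ 2 / G%:R) G A.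

(** Let [tau a] be a supporting slope at [a]. The chord of two points has slope between their values
    of [tau], so [tau] decreases to the right and the bucket of [1 - tau] increases. At most [2 * M]
    pairs of a column and a bucket are therefore met, and each holds a chain that is monotone after
    a shear. *)
Lemma supported_chain_bound {R : realType} (D M G : nat) (e : R) (A S : set (plane R)) :
  (2 <= M)%N -> (0 < G)%N -> `|e| = 1 -> finite_set A -> S `<=` A `&` strip D ->
  (2 <= D)%N ->
  shear_thin M G e A ->
  (forall a, S a -> exists2 t : R, `|t| <= 1 & supported e S a t) ->
  (ncard S <= 2 * M * (6 * G))%N.
Proof.
move=> M2 G0 e1 fA SA D2 th sup.
have fS : finite_set S by apply: sub_finite_set fA; move=> a /SA[].
have M0 : 0 < M%:R :> R by rewrite ltr0n (leq_trans _ M2).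
have M2R : 2 <= M%:R :> R by rewrite ler_nat.
have D0 : 0 < D%:R :> R by rewrite ltr0n (leq_trans _ D2).
have G0R : 0 < G%:R :> R by rewrite ltr0n.
have del2 : D%:R^-1 <= 2^-1 :> R by rewrite lef_pV2// ?posrE// ler_nat.
have W a : S a -> [/\ - 2^-1 <= a.1, a.1 < 2^-1, 0 <= a.2 & a.2 < 1].
  by move=> /SA[_ [/andP[? ?] /andP[? ?]]]; split=> //; lra.
have /choice[tau tauP] : forall a, exists t : R, S a -> `|t| <= 1 /\ supported e S a t.
  move=> a; have [/sup[t t1 ts]|nSa] := pselect (S a); first by exists t.
  by exists 0.
have s0 : 0 < 2 / M%:R :> R by rewrite divr_gt0.
have Ms : M%:R * (2 / M%:R) = 2 :> R by rewrite mulrCA mulfV ?mulr1// lt0r_neq0.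
have iM0 : 0 < M%:R^-1 :> R by rewrite invr_gt0.
have MiM : M%:R * M%:R^-1 = 1 :> R by rewrite mulfV// lt0r_neq0.
have s1 : 2 / M%:R <= 1 :> R by rewrite ler_pdivrMr ?mul1r.
(* There are [M.+1] buckets because [1 - tau a = 2] is possible. *)
have /choice[cr crP] : forall a, exists ij : nat * nat, S a ->
    [/\ (ij.1 < M)%N /\ (ij.2 < M.+1)%N,
       - 2^-1 + ij.1%:R / M%:R <= a.1 < - 2^-1 + ij.1.+1%:R / M%:R &
       ij.2%:R * (2 / M%:R) <= 1 - tau a < ij.2.+1%:R * (2 / M%:R)].
  move=> a; have [Sa|nSa] := pselect (S a); last by exists (0, 0)%N.
  have [a1 a2 _ _] := W a Sa; have [ta _] := tauP a Sa.
  have [||i [iM i1 i2]] := @truncn_grid R a.1 (- 2^-1) M%:R^-1 M => //.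
    by rewrite MiM; lra.
  have [||j [jM j1 j2]] := @truncn_grid R (1 - tau a) 0 (2 / M%:R) M.+1 => //.
    by move: ta; rewrite ler_norml add0r -[M.+1]addn1 (natrD _ M 1) (mulrDl M%:R 1%:R) Ms; lra.
  exists (i, j) => _; rewrite !add0r in j1 j2; split=> //=; by rewrite ?i1 ?j1.
pose col a := (cr a).1; pose row a := (cr a).2.
have step a b : S a -> S b -> a.1 < b.1 ->
    tau b * (b.1 - a.1) <= e * (b.2 - a.2) <= tau a * (b.1 - a.1).
  move=> Sa Sb ab; have [_ /(_ b Sb) h1] := tauP a Sa.
  by have [_ /(_ a Sa) h2] := tauP b Sb; rewrite h1 andbT; lra.
have crmono a b : S a -> S b -> (col a < col b)%N -> (row a <= row b)%N.
  move=> Sa Sb ab; have [_ /andP[a1 a2] /andP[a3 a4]] := crP a Sa.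
  have [_ /andP[b1 b2] /andP[b3 b4]] := crP b Sb.
  have lt : a.1 < b.1.
    apply: lt_le_trans a2 (le_trans _ b1).
    by rewrite lerD2l ler_pM2r// ler_nat.
  have /andP[u1 u2] := step a b Sa Sb lt.
  have tt : tau b <= tau a by rewrite -(ler_pM2r (_ : 0 < b.1 - a.1)) ?subr_gt0// (le_trans u1).
  rewrite -ltnS -(ltr_nat R) -(ltr_pM2r s0).
  by apply: le_lt_trans a3 (le_lt_trans _ b4); rewrite lerD2l lerN2.
pose F := stair S col row.
pose Sij i j := [set a | [/\ S a, col a = i & row a = j]].
have fSij i j : finite_set (Sij i j) by apply: sub_finite_set fS => a [].
have bSij i j : (ncard (Sij i j) <= 6 * G)%N.
  have [->|Sn0] := eqVneq (Sij i j) set0; first by rewrite /ncard fset_set0 cardfs0.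
  have {}Sn0 : Sij i j !=set0 by apply/set0P.
  pose s : R := 1 - j.+1%:R * (2 / M%:R).
  have [iM jM] : (i < M)%N /\ (j < M.+1)%N.
    by have [c [Sc <- <-]] := Sn0; have [] := crP c Sc.
  have s2 : -2 <= s <= 1.
    have : j.+1%:R * (2 / M%:R) <= M.+1%:R * (2 / M%:R) :> R by rewrite ler_pM2r// ler_nat.
    have : 0 <= j.+1%:R * (2 / M%:R) :> R by rewrite mulr_ge0// ltW.
    by rewrite /s -[M.+1]addn1 (natrD _ M 1) (mulrDl M%:R 1%:R) Ms; lra.
  have tauS a : Sij i j a -> s <= tau a <= s + 2 / M%:R.
    move=> [Sa ca ra]; have [_ _] := crP a Sa;
      rewrite -/(row a) ra /s -[j.+1]addn1 (natrD _ j 1) (mulrDl j%:R 1%:R) mul1r.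
    by lra.
  have colS a : Sij i j a -> - 2^-1 + i%:R * M%:R^-1 <= a.1 < - 2^-1 + i.+1%:R * M%:R^-1.
    by move=> [Sa ca ra]; have [_ + _] := crP a Sa; rewrite -/(col a) ca.
  pose f (x : plane R) := e * x.2 - s * x.1.
  pose eta : R := 2 / M%:R ^+ 2.
  have eta0 : 0 < eta by rewrite divr_gt0// exprn_gt0.
  have etaE : eta = (2 / M%:R) * M%:R^-1 by rewrite /eta expr2 invfM mulrA.
  (* Chord slopes are between [s] and [s + 2 / M] and the column has width [1 / M], so the sheared
     chain rises, by at most [eta]. *)
  have incr a b : Sij i j a -> Sij i j b -> a.1 < b.1 -> f a <= f b <= f a + eta.
    move=> Ha Hb ab; have [Sa _ _] := Ha; have [Sb _ _] := Hb.
    have /andP[u1 u2] := step a b Sa Sb ab.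
    have ab0 : 0 < b.1 - a.1 by rewrite subr_gt0.
    have abM : b.1 - a.1 <= M%:R^-1.
      have := colS a Ha; have := colS b Hb;
        rewrite -[i.+1]addn1 (natrD _ i 1) (mulrDl i%:R 1%:R) mul1r; lra.
    have /andP[tb1 tb2] := tauS b Hb; have /andP[ta1 ta2] := tauS a Ha.
    have k1 : s * (b.1 - a.1) <= tau b * (b.1 - a.1) by rewrite ler_pM2r.
    have k2 : tau a * (b.1 - a.1) <= (s + 2 / M%:R) * (b.1 - a.1) by rewrite ler_pM2r.
    have k3 : 2 / M%:R * (b.1 - a.1) <= eta by rewrite etaE ler_pM2l.
    by rewrite /f; lra.
  have same a b : Sij i j a -> Sij i j b -> a.1 = b.1 -> f a <= f b.
    move=> [Sa _ _] [Sb _ _] ab; have [_ /(_ a Sa)] := tauP b Sb.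
    by rewrite /f ab subrr mulr0; lra.
  have f1 a : Sij i j a -> 0 <= f a + 2 < (2 * M ^ 2)%N%:R * eta.
    move=> [Sa _ _]; have [a1 a2 a3 a4] := W a Sa.
    have -> : (2 * M ^ 2)%N%:R * eta = 4 by rewrite natrM natrX /eta; field; rewrite lt0r_neq0.
    have h1 : `|e * a.2| < 1 by rewrite normrM e1 mul1r ger0_norm.
    have h2 : `|s * a.1| <= 1.
      rewrite normrM; apply: (@le_trans _ _ (2 * 2^-1)); last by rewrite mulfV.
      by apply: ler_pM => //; rewrite ler_norml; lra.
    by move: h1 h2; rewrite ltr_norml ler_norml /f; lra.
  have f2 a b : Sij i j a -> Sij i j b -> f a + 2 <= f b + 2 + eta.
    move=> Ha Hb; have [ab|ab|ab] := ltgtP a.1 b.1.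
    - by have := incr a b Ha Hb ab; lra.
    - by have := incr b a Hb Ha ab; lra.
    - by have := same a b Ha Hb ab; lra.
  have [k kM kP] := window_select _ (fun x => f x + 2) _ _ eta0 Sn0 f1 f2.
  have h10 : 0 < M%:R^-1 / G%:R :> R by rewrite divr_gt0.
  have h20 : 0 < 4 / M%:R ^+ 2 / G%:R :> R by rewrite !divr_gt0// exprn_gt0.
  apply/ltnW/(chain_bound _ _ _ _ _ _ _ _ _ G0 h10 h20 fA (th i j k iM jM kM)).
  - by move=> a [/SA[]].
  - move=> a Ha; split.
      have -> : G%:R * (M%:R^-1 / G%:R) = M%:R^-1 :> R by field; rewrite !lt0r_neq0.
      by have := colS a Ha; rewrite -[i.+1]addn1 (natrD _ i 1) (mulrDl i%:R 1%:R) mul1r addrA.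
    have -> : G%:R * (4 / M%:R ^+ 2 / G%:R) = 2 * eta by rewrite /eta; field;
      rewrite !lt0r_neq0.
    by have := kP a Ha; rewrite -[k.+2]addn2 (natrD _ k 2) (mulrDl k%:R 2%:R) -/s -/eta /f; lra.
  - move=> a b Ha Hb ab; by have /andP[] := incr a b Ha Hb ab.
(* Slopes decrease along the chain, so the (column, bucket) pairs it meets again
   form a staircase. *)
have Ssub : S `<=` \big[setU/set0]_(i < M) \big[setU/set0]_(F i <= j < (F i.+1).+1) Sij i j.
  move=> a Sa; have [[c1 c2] _ _] := crP a Sa.
  rewrite -(bigcup_mkord M (fun i => \big[setU/set0]_(F i <= j < (F i.+1).+1) Sij i j)).
  exists (col a) => //=; rewrite -bigcup_seq; exists (row a) => //=.
  by rewrite mem_index_iota ltnS stair_le ?stair_ge.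
have fin2 i : finite_set (\big[setU/set0]_(F i <= j < (F i.+1).+1) Sij i j).
  by rewrite -bigcup_seq; apply: bigcup_finite => //; exact: finite_seq.
have fin3 : finite_set (\big[setU/set0]_(i < M) \big[setU/set0]_(F i <= j <
  (F i.+1).+1) Sij i j).
  rewrite -(bigcup_mkord M (fun i => \big[setU/set0]_(F i <= j < (F i.+1).+1) Sij i j)).
  by apply: bigcup_finite => //; exact: finite_II.
apply: leq_trans (ncard_sub _ _ fin3 Ssub) _.
apply: leq_trans (ncard_bigsetU _ _ _ _) _ => //.
apply: (@leq_trans (\sum_(i < M) ((F i.+1).+1 - F i) * (6 * G))).
  apply: leq_sum => i _; apply: leq_trans (ncard_bigsetU _ _ _ _) _; first exact: fSij.
  by rewrite -sum_nat_const_nat; apply: leq_sum => j _; exact: bSij.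
rewrite -big_distrl/= leq_mul2r; apply/orP; right.
have -> : (2 * M = M + M)%N by rewrite mul2n addnn.
apply: stair_area => [i|]; first exact: stair_homo.
by apply: stair_bound => // a Sa; have [[_ +] _ _] := crP a Sa; rewrite ltnS.
Qed.

(** * Points of a layer in the strip *)

Lemma layer_bound {R : realType} (D M G G' k : nat) (A : set (plane R)) :
  (2 <= D)%N -> (2 <= M)%N -> (0 < G)%N -> (0 < G')%N -> finite_set A ->
  cone_thin D G A -> (forall e : R, `|e| = 1 -> shear_thin M G' e A) ->
  (ncard [set a | [/\ strip D a, remaining A k a & ~ interior (peel stadium A k) a]]
    <= 2 * (6 * G + 2 * M * (6 * G')))%N.
Proof.
move=> D2 M2 G0 G'0 fA cA sA; set L := [set a | _].
pose Ls (e : R) := [set a | L a /\ ~ side e (remaining A k) a].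
pose Lt (e : R) := [set a | L a /\ exists2 t : R, `|t| <= 1 & supported e (remaining A k) a t].
have LA a : L a -> A a /\ strip D a by move=> [? /remaining_sub].
have fL : finite_set L by apply: sub_finite_set fA => a /LA[].
have fLs e : finite_set (Ls e) by apply: sub_finite_set fL => a [].
have fLt e : finite_set (Lt e) by apply: sub_finite_set fL => a [].
have Lse e : `|e| = 1 -> (ncard (Ls e) <= 6 * G)%N.
  move=> e1; apply: (lipschitz_chain_bound D G A) => //; first by move=> a [/LA].
  move=> a b [[_ ka _] na] [[_ kb _] nb].
  have h1 : e * (b.1 - a.1) <= `|b.2 - a.2|.
    by rewrite leNgt; apply/negP => h; apply: na; exists b.
  have h2 : e * (a.1 - b.1) <= `|b.2 - a.2|.
    by rewrite distrC leNgt; apply/negP => h; apply: nb; exists a.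
  have -> : `|a.1 - b.1| = `|e * (a.1 - b.1)| by rewrite normrM e1 mul1r.
  by rewrite [X in _ <= X]distrC ler_norml h2 andbT; lra.
have Lte e : `|e| = 1 -> (ncard (Lt e) <= 2 * M * (6 * G'))%N.
  move=> e1; apply: (supported_chain_bound D M G' e A) => //.
  - by move=> a [/LA].
  - exact: sA.
  - by move=> a [_ [t t1 ts]]; exists t => // b [[_ kb _] _]; exact: ts.
have fe e : finite_set (Ls e `|` Lt e) by rewrite finite_setU.
have cov : L `<=` (Ls 1 `|` Lt 1) `|` (Ls (-1) `|` Lt (-1)).
  move=> a La; have [_ _] := La; rewrite peelE => /peeled[e [e1 h]].
  have [ee|ee] := normr_eq1 e e1.
  - by left; rewrite ee in h; case: h => h; [left|right].
  - by right; rewrite ee in h; case: h => h; [left|right].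
apply: leq_trans (ncard_sub _ _ _ cov) _; first by rewrite finite_setU.
rewrite mul2n -addnn; apply: leq_trans (ncardU _ _ _ _) _ => //.
by apply: leq_add; apply: leq_trans (ncardU _ _ _ _) _ => //;
  apply: leq_add; (apply: Lse || apply: Lte); rewrite ?normrN normr1.
Qed.

(* With [N = 4 m^3 l] and [N^2] the intensity, [96 m^5 l^2] is a quarter of the mean
   number of points in the strip, a layer has at most [4704 m^2 l] points there, and
   [N / 400] layers are too few to exhaust them. *)
Lemma high_point {R : realType} (D m l : nat) (A : set (plane R)) :
  m = (24 * D)%N -> (2 <= D)%N -> (0 < l)%N -> finite_set A ->
  cone_thin D (384 * m ^ 2 * l) A ->
  (forall e : R, `|e| = 1 -> shear_thin (4 * m ^ 2) l e A) ->
  (96 * m ^ 5 * l ^ 2 <= ncard (A `&` strip D))%N ->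
  exists a k, [/\ strip D a, height stadium A a = k%:R & (4 * m ^ 3 * l < 400 * k)%N].
Proof.
move=> mE D2 l0 fA cA sA big.
have m48 : (48 <= m)%N by lia.
have m0 : (0 < m)%N by lia.
apply: contrapT => no.
pose K := ((4 * m ^ 3 * l) %/ 400).+1.
pose L k := [set a | [/\ strip D a, remaining A k a & ~ interior (peel stadium A k) a]].
have fL k : finite_set (L k) by apply: sub_finite_set fA => a [_ /remaining_sub].
have cov : A `&` strip D `<=` \big[setU/set0]_(k < K) L k.
  move=> a [Aa Wa]; have [k [hk [lt nk]]] := height_stadium A a fA.
  rewrite -bigcup_mkord; exists k => /=.
    rewrite /K ltnS leq_divRL// mulnC leqNgt; apply/negP => h; apply: no.
    by exists a, k.
  by split=> //; case: (k) lt => [|j] lt //=; split=> //; exact: lt.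
have fK : finite_set (\big[setU/set0]_(k < K) L k).
  by rewrite -bigcup_mkord; apply: bigcup_finite => //; exact: finite_II.
have := leq_trans big (leq_trans (ncard_sub _ _ fK cov)
  (ncard_bigsetU _ _ (fun k : 'I_K => L k) (fun k => fL k))).
apply/negP; rewrite -ltnNge.
have M2 : (2 <= 4 * m ^ 2)%N by nia.
have G0 : (0 < 384 * m ^ 2 * l)%N by rewrite !muln_gt0/= m0 l0.
apply: (@leq_ltn_trans (\sum_(k < K) 2 * (6 * (384 * m ^ 2 * l) + 2 * (4 * m ^ 2) * (6 * l)))).
  by apply: leq_sum => k _; exact: layer_bound.
rewrite sum_nat_const card_ord.
have -> : (2 * (6 * (384 * m ^ 2 * l) + 2 * (4 * m ^ 2) * (6 * l)) = 4704 * (m ^ 2 * l))%N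
  by lia.
have hK : (400 * K <= 4 * (m ^ 3 * l) + 400)%N.
  by rewrite /K mulnS addnC leq_add2r mulnC mulnA leq_divM.
have p144 : (144 <= m ^ 3 * l)%N.
  apply: leq_trans (leq_pmulr _ l0); rewrite (_ : 144 = 48 * 3)%N// expnS leq_mul//.
  by apply: leq_trans (leq_pmulr _ m0); apply: leq_trans m48.
have -> : (96 * m ^ 5 * l ^ 2 = 96 * (m ^ 3 * l) * (m ^ 2 * l))%N.
  by rewrite (expnD m 3 2) -(mulnn l); move: (m ^ 3)%N (m ^ 2)%N => p q; lia.
have ml0 : (0 < m ^ 2 * l)%N by rewrite muln_gt0 expn_gt0 m0 l0.
rewrite mulnA ltn_pmul2r//.
have fin p q : (400 * q <= 4 * p + 400 -> 144 <= p -> q * 4704 < 96 * p)%N by lia.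
exact: fin hK p144.
Qed.

(** * Poisson tails *)

Section PoissonTails.
Context {R : realType}.
Implicit Types (mu x : R) (k n : nat).

Definition poisson_weight mu k : R := mu ^+ k / k`!%:R * expR (- mu).

Lemma poisson_prob_set1 mu k : 0 <= mu ->
  poisson_prob mu k [set k] = (poisson_weight mu k)%:E.
Proof.
rewrite /poisson_prob /poisson_weight le_eqVlt => /orP[/eqP <-|mu0].
  rewrite ltxx oppr0 expR0 mulr1 diracE; case: k => [|k].
    by rewrite mem_set// expr0 fact0 divr1.
  rewrite memNset//= expr0n/= mul0r//.
by rewrite mu0 esum_set1 ?lee_fin ?poisson_pmf_ge0// /poisson_pmf mu0.
Qed.

Lemma exp_partial_le x n : 0 <= x -> \sum_(0 <= j < n) x ^+ j / j`!%:R <= expR x.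
Proof.
move=> x0; have := @nondecreasing_cvgn_le _ (series (exp_coeff x)) _
  (is_cvg_series_exp_coeff x) n.
apply; apply/nondecreasing_seqP => i.
by rewrite seriesSr lerDl /exp_coeff/= divr_ge0// exprn_ge0.
Qed.

(** Termwise, [x ^+ j <= 2^-k (2 x)^j] for [k <= j]: Markov's inequality for 2 to the power of a
    Poisson count, before normalization. *)
Lemma exp_remainder_le x k : 0 <= x ->
  expR x - \sum_(0 <= j < k) x ^+ j / j`!%:R <= (2^-1) ^+ k * expR (2 * x).
Proof.
move=> x0; rewrite lerBlDl.
apply: limr_le; first exact: is_cvg_series_exp_coeff.
near=> n; have kn : (k <= n)%N by near: n; exact: nbhs_infty_ge.
rewrite /series/= (big_cat_nat _ kn)//= lerD2l.
apply: (@le_trans _ _ (\sum_(0 <= j < n) (2^-1) ^+ k * ((2 * x) ^+ j / j`!%:R))); last first.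
  by rewrite -big_distrr/= ler_wpM2l ?exprn_ge0// exp_partial_le// mulr_ge0.
rewrite [leRHS](big_cat_nat _ kn)//=.
apply: (@le_trans _ _ (\sum_(k <= j < n) (2^-1) ^+ k * ((2 * x) ^+ j / j`!%:R))); last first.
  by rewrite lerDr sumr_ge0// => j _;
    rewrite mulr_ge0 ?exprn_ge0// divr_ge0// exprn_ge0// mulr_ge0.
rewrite big_nat_cond [leRHS]big_nat_cond; apply: ler_sum => j /andP[/andP[kj _] _].
rewrite exprMn mulrA -mulrA mulrA mulrA ler_wpM2r ?invr_ge0// ler_peMl ?exprn_ge0//.
rewrite -(subnK kj) exprD mulrCA -exprMn mulVf// expr1n mulr1.
by rewrite exprn_ege1// (ler_nat R 1 2).
Unshelve. all: by end_near. Qed.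

Lemma poisson_upper_tail mu k : 0 <= mu ->
  1 - \sum_(0 <= j < k) poisson_weight mu j <= (2^-1) ^+ k * expR mu.
Proof.
move=> mu0; have := exp_remainder_le mu k mu0.
move=> /(ler_wpM2r (expR_ge0 (- mu))).
rewrite mulrBl -expRD subrr expR0 -mulrA -expRD (_ : 2 * mu - mu = mu); last lra.
by rewrite big_distrl.
Qed.

(** The mirror argument, with [mu ^+ j <= 2^k (mu / 2)^j] for [j < k]. *)
Lemma poisson_lower_tail mu k : 0 <= mu ->
  \sum_(0 <= j < k) poisson_weight mu j <= 2 ^+ k * expR (- (mu / 2)).
Proof.
move=> mu0; have mu2 : 0 <= mu / 2 by rewrite divr_ge0.
have -> : expR (- (mu / 2)) = expR (mu / 2) * expR (- mu).
  by rewrite -expRD; congr expR; lra.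
rewrite mulrA -big_distrl/= ler_wpM2r ?expR_ge0//.
apply: le_trans (ler_wpM2l _ (exp_partial_le (mu / 2) k mu2)); last by rewrite exprn_ge0.
rewrite big_distrr/= big_nat_cond [leRHS]big_nat_cond; apply: ler_sum => j /andP[/andP[_ jk] _].
rewrite mulrA ler_wpM2r ?invr_ge0// expr_div_n mulrCA ler_peMr ?exprn_ge0//.
rewrite -(subnK (ltnW jk)) exprD -mulrA mulfV ?expf_neq0// mulr1.
by rewrite exprn_ege1// (ler_nat R 1 2).
Qed.

(** The bound [1 / (1 - x)] at [x = 1/16] is squared five times, with rounding up in between. *)
Lemma expR2_le8 : expR 2 <= 8 :> R.
Proof.
have h x : 0 <= x -> x < 1 -> expR x <= (1 - x)^-1.
  move=> x0 x1; have := expR_ge1Dx (- x).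
  rewrite expRN -[X in X <= _]invrK lef_pV2 ?posrE ?expR_gt0 ?invr_gt0; lra.
have dbl x a b : expR x <= a -> a * a <= b -> expR (2 * x) <= b.
  move=> xa; apply: le_trans; rewrite (_ : 2 * x = x + x); last lra.
  by rewrite expRD ler_pM ?expR_ge0.
have e0 : expR (16^-1) <= 16 / 15 :> R.
  have -> : 16 / 15 = (1 - 16^-1)^-1 :> R by rewrite (_ : 1 - 16^-1 = 15 / 16) ?invf_div//; lra.
  by apply: h; lra.
have e1 : expR (2 * 16^-1) <= 33 / 29 :> R by apply: dbl e0 _; lra.
have e2 : expR (2 * (2 * 16^-1)) <= 57 / 44 :> R by apply: dbl e1 _; lra.
have e3 : expR (2 * (2 * (2 * 16^-1))) <= 47 / 28 :> R by apply: dbl e2 _; lra.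
have e4 : expR (2 * (2 * (2 * (2 * 16^-1)))) <= 31 / 11 :> R by apply: dbl e3 _; lra.
have := dbl _ _ 8 e4 _; rewrite (_ : 2 * (2 * (2 * (2 * (2 * 16^-1)))) = 2); last lra.
by apply; lra.
Qed.

End PoissonTails.

(** * Areas of cells *)

Section PlaneMeasure.
Context {R : realType}.
Implicit Types (a b h : R).

Lemma measurable_band (f : mplane R -> R) a b : measurable_fun setT f ->
  measurable [set x : mplane R | a <= f x < b].
Proof.
move=> mf; rewrite -[X in measurable X]setTI.
have -> : [set x : mplane R | a <= f x < b] = f @^-1` `[a, b[%classic.
  by apply/seteqP; split=> x /=; rewrite in_itv.
exact: mf.
Qed.

Lemma measurable_cell (v w : mplane R -> R) (v0 w0 h1 h2 : R) i j :
  measurable_fun setT v -> measurable_fun setT w ->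
  measurable (cell v w v0 w0 h1 h2 i j : set (mplane R)).
Proof. by move=> mv mw; apply: measurableI; exact: measurable_band. Qed.

Lemma measurable_shear (e s : R) :
  measurable_fun setT (fun x : mplane R => e * x.2 - s * x.1).
Proof.
apply: measurable_funB; apply: measurable_funM => //; exact: measurable_cst.
Qed.

Lemma measurable_sum : measurable_fun setT (fun x : mplane R => x.2 + x.1).
Proof. exact: measurable_funD. Qed.

Lemma measurable_diff : measurable_fun setT (fun x : mplane R => x.2 - x.1).
Proof. exact: measurable_funB. Qed.

Lemma lebesgue_itv_len (a b : R) (b1 b2 : bool) : a <= b ->
  lebesgue_measure [set` Interval (BSide b1 a) (BSide b2 b)] = (b - a)%:E.
Proof.
move=> ab; rewrite lebesgue_measure_itv/= lte_fin; case: ltP => //= ba.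
by rewrite (_ : b = a) ?subrr//; apply/eqP; rewrite eq_le ab ba.
Qed.

Lemma lebesgue2_rectangle (a b c d : R) (b1 b2 b3 b4 : bool) : a <= b -> c <= d ->
  lebesgue2 ([set` Interval (BSide b1 a) (BSide b2 b)] `*`
             [set` Interval (BSide b3 c) (BSide b4 d)]) = ((b - a) * (d - c))%:E.
Proof.
move=> ab cd; rewrite EFinM -(lebesgue_itv_len _ _ b1 b2 ab) -(lebesgue_itv_len _ _ b3 b4 cd).
exact: product_measure1E.
Qed.

(** A shear preserves area: vertical sections over [I] lie in intervals of length [h2], the others
    are empty. *)
Lemma lebesgue2_shear (e s v0 w0 h1 h2 : R) i j : `|e| = 1 -> 0 <= h1 -> 0 <= h2 ->
  (lebesgue2 (cell fst (fun x => (e * x.2 - s * x.1)%R) v0 w0 h1 h2 i j)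
     <= (h1 * h2)%:E)%E.
Proof.
move=> e1 h10 h20; set C := cell _ _ _ _ _ _ _ _.
have mC : measurable (C : set (mplane R)).
  by apply: measurable_cell; [exact: measurable_fst|exact: measurable_shear].
pose I := `[(v0 + i%:R * h1), (v0 + i.+1%:R * h1)[%classic : set (measurableTypeR R).
have mI : measurable I by exact: measurable_itv.
have I1 : lebesgue_measure I = h1%:E.
  rewrite lebesgue_itv_len; last by rewrite lerD2l ler_wpM2r// ler_nat.
  by congr EFin; rewrite -[i.+1]addn1 (natrD _ i 1) (mulrDl i%:R 1%:R); lra.
apply: (@le_trans _ _ (\int[lebesgue_measure]_x (h2%:E * (\1_I x)%:E))%E); last first.
  rewrite ge0_integralZl_EFin//; last first.
    by apply/measurable_EFinP; exact: measurable_indic.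
  rewrite integral_indic// setIT mulrC EFinM; apply: lee_wpmul2l; first by rewrite lee_fin.
  by have := lexx h1%:E; rewrite -{1}I1.
rewrite /lebesgue2 /product_measure1/=; apply: ge0_le_integral.
- exact: measurableT.
- by move=> x _; exact: measure_ge0.
- exact: measurable_fun_xsection.
- by apply/measurable_EFinP; apply: measurable_funM => //; exact: measurable_indic.
move=> x _; rewrite /=.
have [xI|xI] := boolP (x \in I); last first.
  rewrite (_ : xsection C x = set0) ?measure0 ?indicE ?(negbTE xI) ?mule0//.
  apply/seteqP; split=> y //; rewrite /xsection/= => /set_mem[xi _].
  by move/negP: xI; apply; apply/mem_set; rewrite /I/= in_itv.
rewrite indicE xI mule1.
pose a := w0 + j%:R * h2 + s * x.
have jE : w0 + j.+1%:R * h2 + s * x = a + h2.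
  by rewrite /a -[j.+1]addn1 (natrD _ j 1) (mulrDl j%:R 1%:R); lra.
have sub : xsection C x `<=` [set y | a <= e * y < a + h2].
  by move=> y; rewrite /xsection/= => /set_mem[_ /=]; rewrite -jE /a; lra.
have mx : measurable (xsection C x) by exact: measurable_xsection.
have [ee|ee] := normr_eq1 e e1.
- apply: (@le_trans _ _ (lebesgue_measure `[a, (a + h2)[%classic)).
    apply: le_measure; [exact: mem_set|apply: mem_set; exact: measurable_itv|].
    by move=> y /sub/=; rewrite ee mul1r in_itv.
  by rewrite lebesgue_itv_len ?lee_fin; lra.
- apply: (@le_trans _ _ (lebesgue_measure `](- a - h2), (- a)]%classic)).
    apply: le_measure; [exact: mem_set|apply: mem_set; exact: measurable_itv|].
    by move=> y /sub/=; rewrite ee in_itv/=; lra.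
  by rewrite lebesgue_itv_len ?lee_fin; lra.
Qed.

(** The cell is a tilted square, and its bounding box has both sides equal to [h]. *)
Lemma lebesgue2_diagonal (v0 w0 h : R) i j : 0 <= h ->
  (lebesgue2 (cell (fun x => (x.2 + x.1)%R) (fun x => (x.2 - x.1)%R) v0 w0 h h i j)
     <= (h * h)%:E)%E.
Proof.
move=> h0; set C := cell _ _ _ _ _ _ _ _.
have mC : measurable (C : set (mplane R)).
  by apply: measurable_cell; [exact: measurable_sum|exact: measurable_diff].
pose v := v0 + i%:R * h; pose w := w0 + j%:R * h.
have sub : C `<=` `[((v - w) / 2 - h / 2), ((v - w) / 2 + h / 2)]%classic `*`
                  `[((v + w) / 2), ((v + w) / 2 + h)]%classic.
  move=> x [] /andP[c1 c2] /andP[c3 c4].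
  have iE : v0 + i.+1%:R * h = v + h.
    by rewrite /v -[i.+1]addn1 (natrD _ i 1) (mulrDl i%:R 1%:R); lra.
  have jE : w0 + j.+1%:R * h = w + h.
    by rewrite /w -[j.+1]addn1 (natrD _ j 1) (mulrDl j%:R 1%:R); lra.
  rewrite iE in c2; rewrite jE in c4; rewrite -/v in c1; rewrite -/w in c3.
  by split; rewrite /= in_itv/=; lra.
apply: (@le_trans _ _ (lebesgue2 (`[((v - w) / 2 - h / 2), ((v - w) / 2 + h / 2)]%classic `*`
                  `[((v + w) / 2), ((v + w) / 2 + h)]%classic))).
  apply: le_measure; [exact: mem_set| |exact: sub].
  by apply: mem_set; apply: measurableX; exact: measurable_itv.
by rewrite lebesgue2_rectangle ?lee_fin; nra.
Qed.

Lemma measure_bigsetU_le {d} {T : measurableType d} (mu : {measure set T -> \bar R})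
    (I : Type) (r : seq I) (F : I -> set T) : (forall i, measurable (F i)) ->
  (mu (\big[setU/set0]_(i <- r) F i) <= \sum_(i <- r) mu (F i))%E.
Proof.
move=> mF; elim: r => [|i r IH]; first by rewrite !big_nil measure0.
rewrite !big_cons; apply: le_trans (measureU2 _ _ _) _ => //.
  by apply: bigsetU_measurable.
by rewrite leeD2l.
Qed.

Lemma measurable_stairs (v w : mplane R -> R) (v0 w0 h1 h2 : R) (G : nat) (F : nat -> nat) :
  measurable_fun setT v -> measurable_fun setT w ->
  measurable (stairs v w v0 w0 h1 h2 G F : set (mplane R)).
Proof.
move=> mv mw; apply: bigsetU_measurable => i _; apply: bigsetU_measurable => j _.
exact: measurable_cell.
Qed.

Lemma lebesgue2_stairs (v w : mplane R -> R) (v0 w0 h1 h2 c : R) (G : nat) (F : nat -> nat) :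
  measurable_fun setT v -> measurable_fun setT w -> 0 <= c ->
  (forall i j, (lebesgue2 (cell v w v0 w0 h1 h2 i j) <= c%:E)%E) ->
  (forall i, (i < G)%N -> (F i <= F i.+1)%N) -> (F G <= G)%N ->
  (lebesgue2 (stairs v w v0 w0 h1 h2 G F) <= ((2 * G)%:R * c)%:E)%E.
Proof.
move=> mv mw c0 cc Fm FG.
have mc i j : measurable (cell v w v0 w0 h1 h2 i j : set (mplane R)) by exact: measurable_cell.
apply: le_trans (measure_bigsetU_le _ _ _ _ _) _.
  by move=> i; apply: bigsetU_measurable => j _; exact: mc.
apply: (@le_trans _ _ (\sum_(i < G) ((F i.+1).+1 - F i)%:R%:E * c%:E)%E).
  apply: lee_sum => i _; apply: le_trans (measure_bigsetU_le _ _ _ _ _) _ => //.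
  apply: (@le_trans _ _ (\sum_(F i <= j < (F i.+1).+1) c%:E)%E).
    by apply: lee_sum => j _; exact: cc.
  by rewrite sumEFin sumr_const_nat -EFinM lee_fin mulr_natl.
under eq_bigr do rewrite -EFinM.
rewrite sumEFin lee_fin -big_distrl/= ler_wpM2r// -natr_sum ler_nat.
(* [F] is known to be monotone only up to [G], so it is frozen beyond. *)
have -> : (\sum_(i < G) ((F i.+1).+1 - F i) =
  \sum_(i < G) ((F (minn i.+1 G)).+1 - F (minn i G)))%N.
  apply: eq_bigr => i _; rewrite (minn_idPl _)// (minn_idPl _)//; exact: ltnW.
rewrite mul2n -addnn; apply: (stair_area (fun i => F (minn i G))) => [i|];
  last by rewrite minnn.
have [iG|Gi] := ltnP i G; first by rewrite !(minn_idPl _)// ?Fm// ltnW.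
by rewrite !(minn_idPr _)// ltnW.
Qed.

End PlaneMeasure.

(** * Events of high probability *)

Section Events.
Context {R : realType} {d : measure_display} {Omega : measurableType d}.
Variable P : probability Omega R.

Section Counts.
Variables (n : nat) (X : Omega -> set (plane R)).
Hypothesis PX : poisson_process P square (fun x => n%:R * 1) X.

Lemma measurable_square : measurable (square : set (mplane R)).
Proof.
rewrite (_ : square = `](-1), 1[%classic `*` `](-1), 1[%classic).
  by apply: measurableX; exact: measurable_itv.
by apply/seteqP; split=> x; rewrite /square/= !in_itv/= !ltr_norml => -[].
Qed.

Lemma lebesgue2_square : lebesgue2 (square : set (mplane R)) = 4%:E.
Proof.
rewrite (_ : square = `](-1), 1[%classic `*` `](-1), 1[%classic).
  by rewrite lebesgue2_rectangle; [congr EFin; lra|lra|lra].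
by apply/seteqP; split=> x; rewrite /square/= !in_itv/= !ltr_norml => -[].
Qed.

Definition rate (B : set (mplane R)) : R := n%:R * fine (lebesgue2 (square `&` B)).

Lemma rate_ge0 B : 0 <= rate B.
Proof. by rewrite mulr_ge0// fine_ge0. Qed.

Lemma rate_le B c : measurable B -> (lebesgue2 (square `&` B) <= c%:E)%E ->
  rate B <= n%:R * c.
Proof.
move=> mB Bc; apply: ler_wpM2l => //.
by rewrite -lee_fin fineK// ge0_fin_numE// (le_lt_trans Bc) ?ltry.
Qed.

Lemma points_eq B k : measurable B ->
  P [set w | points_in X B w = k%:R%:E] = (poisson_weight (rate B) k)%:E.
Proof.
have [_ _ PXk _] := PX.
move=> mB; rewrite PXk// -poisson_prob_set1 ?rate_ge0// /rate.
by rewrite Rintegral_cst ?mulr1//; apply: measurableI => //; exact: measurable_square.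
Qed.

Lemma points_nat B w : points_in X B w = +oo%E \/ exists k : nat, points_in X B w = k%:R%:E.
Proof.
rewrite /points_in /counting; case: ifP => _; last by left.
by right; eexists.
Qed.

Lemma measurable_points_eq B k : measurable B ->
  measurable [set w | points_in X B w = k%:R%:E].
Proof.
have [_ mX _ _] := PX; move=> /mX mB.
by rewrite -[X in measurable X]setTI;
  exact: (mB measurableT [set k%:R%:E] (emeasurable_set1 _)).
Qed.

Lemma points_ltS B k : [set w | (points_in X B w < k.+1%:R%:E)%E] =
  [set w | (points_in X B w < k%:R%:E)%E] `|` [set w | points_in X B w = k%:R%:E].
Proof.
apply/seteqP; split=> w /=; have [->|[j ->]] := points_nat B w.
- by rewrite ltNge leey.
- rewrite lte_fin ltr_nat ltnS leq_eqVlt => /orP[/eqP ->|jk]; first by right.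
  by left; rewrite lte_fin ltr_nat.
- by case=> //; rewrite ltNge leey.
- rewrite !lte_fin !ltr_nat => -[jk|[/eqP]]; first by rewrite ltnS ltnW.
  by rewrite eqr_nat => /eqP ->.
Qed.

Lemma points_lt0 B : [set w | (points_in X B w < 0%:R%:E)%E] = set0.
Proof.
apply/seteqP; split=> w //=; have [->|[j ->]] := points_nat B w.
  by rewrite ltNge leey.
by rewrite lte_fin ltr_nat.
Qed.

Lemma measurable_points_lt B k : measurable B ->
  measurable [set w | (points_in X B w < k%:R%:E)%E].
Proof.
move=> mB; elim: k => [|k IH]; first by rewrite points_lt0.
by rewrite points_ltS; apply: measurableU => //; exact: measurable_points_eq.
Qed.

Lemma prob_points_lt B k : measurable B ->
  P [set w | (points_in X B w < k%:R%:E)%E] =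
  (\sum_(0 <= j < k) poisson_weight (rate B) j)%:E.
Proof.
move=> mB; elim: k => [|k IH]; first by rewrite points_lt0 measure0 big_geq.
have dj : [set w | (points_in X B w < k%:R%:E)%E] `&` [set w | points_in X B w = k%:R%:E]
  = set0.
  by apply/seteqP; split=> w //= -[+ e]; rewrite e ltxx.
rewrite points_ltS big_nat_recr//= EFinD.
apply: etrans (measureU P (measurable_points_lt B k mB) (measurable_points_eq B k mB) dj) _.
by congr (_ + _)%E; [exact: IH|exact: points_eq].
Qed.

Lemma points_upper B k c : measurable B -> (lebesgue2 (square `&` B) <= c%:E)%E ->
  (P (~` [set w | (points_in X B w < k%:R%:E)%E]) <= ((2^-1) ^+ k * expR (n%:R * c))%:E)%E.
Proof.
move=> mB Bc; rewrite probability_setC; last exact: measurable_points_lt.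
rewrite prob_points_lt// -EFinB lee_fin.
apply: le_trans (poisson_upper_tail _ _ (rate_ge0 B)) _.
by rewrite ler_wpM2l ?exprn_ge0// ler_expR rate_le.
Qed.

Lemma points_lower B k : measurable B ->
  (P [set w | (points_in X B w < k%:R%:E)%E] <= (2 ^+ k * expR (- (rate B / 2)))%:E)%E.
Proof. by move=> mB; rewrite prob_points_lt// lee_fin poisson_lower_tail// rate_ge0. Qed.

Lemma bin_le_exp2 a b : ('C(a, b) <= 2 ^ a)%N.
Proof.
elim: a b => [|a IH] [|b] //; first by rewrite bin0 expn_gt0.
by rewrite binS expnS mul2n -addnn leq_add.
Qed.

(** Origin of the 6 in [thin]: a staircase has mean at most [2 * G], so it holds [6 * G] points with
    probability at most 2^(-6G) e^(2G) <= 2^(-3G), and the union over at most 4^G staircases leaves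
    2^(-G). *)
Lemma thin_prob (v w : mplane R -> R) (v0 w0 h1 h2 c : R) (G : nat) :
  (0 < G)%N -> measurable_fun setT v -> measurable_fun setT w ->
  0 <= c -> n%:R * c <= 1 ->
  (forall i j, (lebesgue2 (cell v w v0 w0 h1 h2 i j) <= c%:E)%E) ->
  exists B, [/\ measurable B, ~` [set o | thin v w v0 w0 h1 h2 G (X o)] `<=` B &
    (P B <= ((2^-1) ^+ G)%:E)%E].
Proof.
case: G => // g _ mv mw c0 nc cc; set G := g.+1.
pose F (t : G.+1.-tuple 'I_G) := nth 0%N (map val t).
pose st (t : G.+1.-tuple 'I_G) := stairs v w v0 w0 h1 h2 G (F t) : set (mplane R).
pose bad t := ~` [set o | (points_in X (st t) o < (6 * G)%:R%:E)%E].
have mst t : measurable (st t) by exact: measurable_stairs.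
have mbad t : measurable (bad t) by apply: measurableC; exact: measurable_points_lt.
pose r := enum (finset (fun t : G.+1.-tuple 'I_G => sorted leq (map val t))).
exists (\big[setU/set0]_(t <- r) bad t); split.
- exact: bigsetU_measurable.
- move=> o /= nth; apply: contrapT => nb; apply: nth => t tsorted.
  apply: contrapT => no; apply: nb; rewrite -bigcup_seq; exists t => //=.
  by rewrite mem_enum finset.in_set.
apply: le_trans (measure_bigsetU_le _ _ _ _ mbad) _.
apply: (@le_trans _ _ (\sum_(t <- r) ((2^-1) ^+ (6 * G) * 8 ^+ G)%:E)%E).
  rewrite big_seq [leRHS]big_seq; apply: lee_sum => t;
    rewrite mem_enum finset.in_set => tsorted.
  apply: le_trans (points_upper _ _ ((2 * G)%:R * c) (mst t) _) _.
    apply: (@le_trans _ _ (lebesgue2 (st t))).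
      apply: le_measure; [apply: mem_set|exact: mem_set|exact: subIsetr].
      by apply: measurableI => //; exact: measurable_square.
    have szt : size (map val t) = G.+1 by rewrite size_map size_tuple.
    apply: lebesgue2_stairs => //.
      move=> i iG; rewrite /F; apply: (sortedP _ tsorted); by rewrite szt ltnS.
    rewrite /F (nth_map ord0) ?size_tuple//; exact/ltnW/ltn_ord.
  rewrite lee_fin ler_wpM2l ?exprn_ge0//.
  apply: (@le_trans _ _ (expR (G%:R * 2))).
    by rewrite ler_expR natrM; have := ler_wpM2l (ler0n R G) nc; lra.
  by rewrite expRM_natl lerXn2r ?nnegrE ?expR_ge0// expR2_le8.
rewrite sumEFin lee_fin big_const_seq iter_addr_0 count_predT.
have -> : size r = 'C(G.+1 + g, G.+1) by rewrite -cardE card_sorted_tuples.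
rewrite -[_ *+ 'C(_, _)]mulr_natr.
apply: (@le_trans _ _ ((2^-1) ^+ (6 * G) * 8 ^+ G * 4 ^+ G)).
  apply: ler_wpM2l; first by rewrite mulr_ge0 ?exprn_ge0.
  rewrite -natrX ler_nat; apply: leq_trans (bin_le_exp2 _ _) _.
  by rewrite (_ : 4 = 2 ^ 2)%N// -expnM leq_exp2l// /G; lia.
rewrite exprM -!exprMn lerXn2r ?nnegrE//; lra.
Qed.

Lemma finite_prob (l : nat) : exists B, [/\ measurable B,
  ~` [set o | finite_set (X o)] `<=` B & (P B <= ((2^-1) ^+ l)%:E)%E].
Proof.
(* The mean is at most [4 n], and 2^(-12n) e^(4n) <= 1 leaves 2^(-l). *)
exists (~` [set w | (points_in X setT w < (6 * (2 * n) + l)%:R%:E)%E]); split.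
- by apply: measurableC; exact: measurable_points_lt.
- move=> o /= nf lt; apply: nf; move: lt; rewrite /points_in setIT /counting.
  by case: asboolP => //; rewrite ltNge leey.
apply: le_trans (points_upper _ _ 4 _ _) _ => //.
  by rewrite setIT lebesgue2_square.
rewrite lee_fin exprD mulrAC ler_piMl ?exprn_ge0//.
have -> : n%:R * 4 = (2 * n)%:R * 2 :> R by rewrite natrM; lra.
rewrite expRM_natl exprM -exprMn exprn_ile1// ?mulr_ge0 ?expR_ge0 ?exprn_ge0//.
have := expR2_le8 (R := R); lra.
Qed.

End Counts.

(* With high probability. The heights need not be measurable functions on [Omega],
   hence the measurable [B]. *)
Definition whp (Q : nat -> set Omega) : Prop :=
  exists C : R, forall l, (0 < l)%N -> exists B,
    [/\ measurable B, ~` Q l `<=` B & (P B <= (C * (2^-1) ^+ l)%:E)%E].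

Lemma whp_sub (Q Q' : nat -> set Omega) :
  (forall l, (0 < l)%N -> Q l `<=` Q' l) -> whp Q -> whp Q'.
Proof.
move=> QQ' [C QC]; exists C => l l0; have [B [mB QB PB]] := QC l l0.
by exists B; split=> // w nQ; apply: QB => /(QQ' l l0).
Qed.

Lemma whpI (Q Q' : nat -> set Omega) : whp Q -> whp Q' -> whp (fun l => Q l `&` Q' l).
Proof.
move=> [C QC] [C' QC']; exists (C + C') => l l0.
have [B [mB QB PB]] := QC l l0; have [B' [mB' QB' PB']] := QC' l l0.
exists (B `|` B'); split; first exact: measurableU.
  by rewrite setCI; exact: setUSS.
by apply: le_trans (measureU2 _ mB mB') _; rewrite mulrDl EFinD leeD.
Qed.

Lemma whp_forall (K : nat) (Q : nat -> nat -> set Omega) :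
  (forall i, (i < K)%N -> whp (Q i)) ->
  whp (fun l => [set w | forall i, (i < K)%N -> Q i l w]).
Proof.
elim: K => [|K IH] QK.
  by exists 0 => l l0; exists set0; split=> //; [move=> w; apply|rewrite measure0 mul0r].
have h1 := IH (fun i iK => QK i (leqW iK)).
apply: whp_sub (whpI _ _ h1 (QK K (leqnn _))) => l l0 w [w1 w2] i.
by rewrite ltnS leq_eqVlt => /orP[/eqP ->|/w1].
Qed.

(** Failure for all [l >= l0] is contained in each single failure, whose probability tends to 0.
    Hence the joint law of the processes for different [n] may be arbitrary. *)
Lemma whp_negligible (Q : nat -> set Omega) : whp Q ->
  P.-negligible [set w | exists l0, forall l, (l0 <= l)%N -> ~ Q l w].
Proof.
move=> [C QC].
have -> : [set w | exists l0, forall l, (l0 <= l)%N -> ~ Q l w] =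
    \bigcup_l0 [set w | forall l, (l0 <= l)%N -> ~ Q l w].
  by apply/seteqP; split=> w [l0] h; exists l0.
apply: negligible_bigcup => l0.
have /choice[B BP] : forall l, exists B, [/\ measurable B, ~` Q l.+1 `<=` B &
    (P B <= (C * (2^-1) ^+ l.+1)%:E)%E] by move=> l; exact: QC.
exists (\bigcap_(l in [set l | (l0 <= l)%N]) B l); split.
- by apply: bigcap_measurable => [|l _]; [exists l0 => /=|have [] := BP l].
- apply/eqP; rewrite eq_le measure_ge0 andbT.
  apply/lee_addgt0Pr => e e0; rewrite add0e.
  have cv : geometric C (2^-1) @ \oo --> (0 : R).
    by apply: cvg_geometric; rewrite ger0_norm// invf_lt1// (ltr_nat R 1 2).
  have [N _ hN] : \forall l \near \oo, geometric C (2^-1) l < e by exact: cvgr_lt cv _ e0.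
  pose l := maxn l0 N.
  have [mB _ PB] := BP l.
  apply: (@le_trans _ _ (P (B l))).
    apply: le_measure; [apply: mem_set|exact: mem_set|by move=> w; apply; exact: leq_maxl].
    by apply: bigcap_measurable => [|j _]; [exists l0 => /=|have [] := BP j].
  apply: le_trans PB _; rewrite lee_fin ltW//; apply: (hN l.+1) => /=; exact/leqW/leq_maxr.
- move=> w h l /= l0l; have [_ + _] := BP l; apply; apply: h; exact: leqW.
Qed.

End Events.

(** * Intensities and grids for which all bounds hold together *)

Section Good.
Context {R : realType} {d : measure_display} {Omega : measurableType d}.
Variables (P : probability Omega R) (X : nat -> Omega -> set (plane R)).
Hypothesis PX : forall n, (0 < n)%N ->
  poisson_process P square (fun x => n%:R * 1) (X n).

Lemma half_exp_le a b : (a <= b)%N -> (2^-1) ^+ b <= (2^-1) ^+ a :> R.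
Proof. by move=> ab; rewrite ler_wiXn2l// invf_le1// (ler_nat R 1 2). Qed.

Lemma whp_thin (v w : mplane R -> R) (v0 w0 : R) (h1 h2 c : nat -> R) (G n : nat -> nat) :
  measurable_fun setT v -> measurable_fun setT w ->
  (forall l, (0 < l)%N -> [/\ (0 < n l)%N, (l <= G l)%N, 0 <= c l, (n l)%:R * c l <= 1 &
    forall i j, (lebesgue2 (cell v w v0 w0 (h1 l) (h2 l) i j) <= (c l)%:E)%E]) ->
  whp P (fun l => [set o | thin v w v0 w0 (h1 l) (h2 l) (G l) (X (n l) o)]).
Proof.
move=> mv mw H; exists 1 => l l0; have [n0 lG c0 nc cc] := H l l0.
have G0 : (0 < G l)%N := leq_trans l0 lG.
have [B [mB QB PB]] := thin_prob P (n l) _ (PX _ n0) v w v0 w0 (h1 l) (h2 l) (c l)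
  (G l) G0 mv mw c0 nc cc.
exists B; split=> //; apply: le_trans PB _.
by rewrite lee_fin mul1r half_exp_le.
Qed.

Definition good (D m l : nat) : set Omega := [set w |
  let A := X ((4 * m ^ 3 * l) ^ 2)%N w in
  [/\ finite_set A, cone_thin D (384 * m ^ 2 * l) A,
      forall e : R, `|e| = 1 -> shear_thin (4 * m ^ 2) l e A &
      (96 * m ^ 5 * l ^ 2 <= ncard (A `&` strip D))%N]].

Variables (D m : nat).
Hypotheses (D2 : (2 <= D)%N) (mE : m = (24 * D)%N).

Let m0 : (0 < m)%N. Proof. lia. Qed.
Let D0R : D%:R != 0 :> R. Proof. by rewrite pnatr_eq0; lia. Qed.
Let mR : m%:R = 24 * D%:R :> R. Proof. by rewrite mE natrM. Qed.
Let n0 l : (0 < l)%N -> (0 < (4 * m ^ 3 * l) ^ 2)%N.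
Proof. by move=> l0; rewrite expn_gt0 !muln_gt0/= !m0 l0. Qed.

Lemma whp_cone_thin : whp P (fun l => [set w |
  cone_thin D (384 * m ^ 2 * l) (X ((4 * m ^ 3 * l) ^ 2)%N w)]).
Proof.
pose Q i j l := [set w | thin (fun x => x.2 + x.1) (fun x => x.2 - x.1)
    (i%:R * (2 / D%:R)) (j%:R * (2 / D%:R)) (4 / D%:R / (384 * m ^ 2 * l)%:R)
    (4 / D%:R / (384 * m ^ 2 * l)%:R) (384 * m ^ 2 * l) (X ((4 * m ^ 3 * l) ^ 2)%N w)].
apply: (@whp_sub _ _ _ _ (fun l => [set w | forall i, (i < D)%N ->
    [set w | forall j, (j < D)%N -> Q i j l w] w])).
  by move=> l l0 w H i j iD jD; exact: H.
apply: whp_forall => i _; apply: whp_forall => j _.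
apply: (whp_thin _ _ _ _ (fun l => 4 / D%:R / (384 * m ^ 2 * l)%:R)
  (fun l => 4 / D%:R / (384 * m ^ 2 * l)%:R)
  (fun l => (4 / D%:R / (384 * m ^ 2 * l)%:R) * (4 / D%:R / (384 * m ^ 2 * l)%:R))).
- exact: measurable_sum.
- exact: measurable_diff.
move=> l l0; have hge : 0 <= 4 / D%:R / (384 * m ^ 2 * l)%:R :> R.
  by apply: divr_ge0; [apply: divr_ge0|]; exact: ler0n.
split.
- exact: n0.
- by rewrite leq_pmull// !muln_gt0/= !m0.
- exact: (mulr_ge0 hge hge).
(* With N = 4 m^3 l, the cell side h = 4 / (384 D m^2 l) satisfies N h = m / (24 D) = 1: this fixes
   [384] and [m = 24 D]. *)
- rewrite !(natrX, natrM) mR le_eqVlt; apply/orP; left; apply/eqP; field.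
  by rewrite D0R pnatr_eq0 -lt0n l0.
- by move=> i' j'; exact: lebesgue2_diagonal.
Qed.

Lemma whp_shear_thin e : `|e| = 1 -> whp P (fun l => [set w |
  shear_thin (4 * m ^ 2) l e (X ((4 * m ^ 3 * l) ^ 2)%N w)]).
Proof.
move=> e1; set M := (4 * m ^ 2)%N.
pose Q i j k l := [set w | thin fst (fun x => e * x.2 - (1 - j.+1%:R * (2 / M%:R)) * x.1)
    (- 2^-1 + i%:R / M%:R) (- 2 + k%:R * (2 / M%:R ^+ 2))
    (M%:R^-1 / l%:R) (4 / M%:R ^+ 2 / l%:R) l (X ((4 * m ^ 3 * l) ^ 2)%N w)].
apply: (@whp_sub _ _ _ _ (fun l => [set w | forall i, (i < M)%N ->
    [set w | forall j, (j < M.+1)%N -> [set w | forall k,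
      (k < 2 * M ^ 2)%N -> Q i j k l w] w] w])).
  by move=> l l0 w H i j k iM jM kM; exact: H.
apply: whp_forall => i _; apply: whp_forall => j _; apply: whp_forall => k _.
apply: (whp_thin _ _ _ _ (fun l => M%:R^-1 / l%:R) (fun l => 4 / M%:R ^+ 2 / l%:R)
  (fun l => (M%:R^-1 / l%:R) * (4 / M%:R ^+ 2 / l%:R)) (fun l => l)).
- exact: measurable_fst.
- exact: measurable_shear.
have M0 : M%:R != 0 :> R by rewrite pnatr_eq0 -lt0n !muln_gt0/= !m0.
move=> l l0; split=> //.
- exact: n0.
(* The cell area is 4 / (M^3 l^2), and M = 4 m^2 gives M^3 l^2 / 4 = (4 m^3 l)^2, the intensity. *)
- rewrite !(natrX, natrM) le_eqVlt; apply/orP; left; apply/eqP; field.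
  by rewrite !pnatr_eq0 -!lt0n l0 m0.
- by move=> i' j'; apply: lebesgue2_shear;
  rewrite ?divr_ge0// ?invr_ge0// ?divr_ge0// exprn_ge0.
Qed.

Lemma whp_finite : whp P (fun l => [set w |
  finite_set (X ((4 * m ^ 3 * l) ^ 2)%N w)]).
Proof.
exists 1 => l l0; have [B [mB QB PB]] := finite_prob P _ _ (PX _ (n0 _ l0)) l.
by exists B; split=> //; rewrite mul1r.
Qed.

Lemma square_strip : square `&` strip D =
  `[(- 2^-1), 2^-1[%classic `*` `](1 - D%:R^-1), 1[%classic :> set (plane R).
Proof.
have D1 : D%:R^-1 <= 1 :> R by rewrite invf_le1 ?ltr0n ?ler1n; lia.
apply/seteqP; split=> x; rewrite /square/strip/= !in_itv/= !ltr_norml; first by case.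
by case=> /andP[a1 a2] /andP[a3 a4]; split; rewrite ?a1 ?a3 ?a2 ?a4; lra.
Qed.

Lemma measurable_strip : measurable (strip D : set (mplane R)).
Proof.
rewrite (_ : strip D = `[(- 2^-1), 2^-1[%classic `*` `](1 - D%:R^-1), 1[%classic).
  by apply: measurableX; exact: measurable_itv.
by apply/seteqP; split=> x; rewrite /strip/= !in_itv.
Qed.

Lemma whp_strip : whp P (fun l => [set w |
  ~ (points_in (X ((4 * m ^ 3 * l) ^ 2)%N) (strip D) w < (96 * m ^ 5 * l ^ 2)%:R%:E)%E]).
Proof.
exists 1 => l l0; set n := ((4 * m ^ 3 * l) ^ 2)%N; set k := (96 * m ^ 5 * l ^ 2)%N.
exists [set w | (points_in (X n) (strip D) w < k%:R%:E)%E]; split.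
- exact: measurable_points_lt (PX _ (n0 _ l0)) _ _ measurable_strip.
- by move=> w /= /contrapT.
apply: le_trans (points_lower _ _ _ (PX _ (n0 _ l0)) _ _ measurable_strip) _.
have D1 : 1 - D%:R^-1 <= 1 :> R by rewrite lerBlDr lerDl invr_ge0.
rewrite lee_fin mul1r /rate square_strip.
rewrite (lebesgue2_rectangle _ _ _ _ _ _ _ _ _ D1)/=; last lra.
(* The mean is [4 k], so the lower tail is at most (2 e^-2)^k, and e^2 >= 4 bounds it by 2^-k. *)
have -> : n%:R * ((2^-1 - - 2^-1) * (1 - (1 - D%:R^-1))) / 2 = k%:R * 2 :> R.
  by rewrite /n /k !(natrX, natrM) mR; field.
rewrite -mulrN expRM_natl -exprMn.
apply: (@le_trans _ _ ((2^-1) ^+ k)); last first.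
  apply: half_exp_le; rewrite /k; have : (0 < m ^ 5)%N by rewrite expn_gt0 m0.
  nia.
have e2 : 4 <= expR 2 :> R.
  rewrite (_ : 2 = 1 + 1) // expRD; have := expR_ge1Dx (1 : R); nra.
rewrite lerXn2r ?nnegrE ?mulr_ge0 ?expR_ge0// expRN.
have : (expR 2)^-1 <= 4^-1 :> R by rewrite lef_pV2 ?posrE ?expR_gt0.
lra.
Qed.

Lemma whp_good : whp P (good D m).
Proof.
have H := whpI _ _ _ (whpI _ _ _ whp_finite whp_cone_thin)
  (whpI _ _ _ (whpI _ _ _ (whp_shear_thin 1 (normr1 _)) (whp_shear_thin (-1)
    (normrN1 _))) whp_strip).
apply: whp_sub H => l l0 w [[fA cA] [[s1 s2] /negP]]; rewrite -leNgt => big.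
split=> //.
  by move=> e /normr_eq1[->|->]; [exact: s1|exact: s2].
by move: big; rewrite /points_in counting_ncard ?lee_fin ?ler_nat//; exact: finite_setIl.
Qed.

End Good.

(** * Behaviour of a continuous limit at the top side, and the contradiction *)

Lemma csquare_edge_top {R : realType} (x : plane R) : x.2 = 1 -> ~ square x.
Proof. by move=> x2 [_]; rewrite x2 normr1 ltxx. Qed.

Lemma compact_csquare {R : realType} : compact (@csquare R).
Proof.
rewrite (_ : csquare = `[(-1), 1]%classic `*` `[(-1), 1]%classic).
  by apply: compact_setX; exact: segment_compact.
by apply/seteqP; split=> x; rewrite /csquare/= !in_itv/= !ler_norml.
Qed.

Lemma strip_sub_square {R : realType} (D : nat) : (0 < D)%N -> strip D `<=` @square R.
Proof.
move=> D0 x [/andP[a1 a2] /andP[a3 a4]].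
have D1 : D%:R^-1 <= 1 :> R by rewrite invf_le1 ?ltr0n ?ler1n.
by split; rewrite ltr_norml; lra.
Qed.

(** Otherwise points of ever thinner strips with values at least [eps] would, by compactness,
    cluster at a point of the top side, where [g] is 0. *)
Lemma small_near_top {R : realType} (g : plane R -> R) (eps : R) : 0 < eps ->
  {within csquare, continuous g} -> (forall x, csquare x -> ~ square x -> g x = 0) ->
  exists2 D, (2 <= D)%N & forall x, strip D x -> g x < eps.
Proof.
move=> e0 gc g0; apply: contrapT => no.
have /choice[u uP] : forall D : nat, exists x : plane R, strip D.+2 x /\ eps <= g x.
  move=> D; apply: contrapT => nx; apply: no; exists D.+2 => // x sx.
  by rewrite ltNge; apply/negP => gx; apply: nx; exists x.
have uc D : csquare (u D).
  have [/strip_sub_square/= -/(_ isT)[u1 u2] _] := uP D.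
  by split; exact: ltW.
have [p [pc /= cl]] : csquare `&` cluster (u @ \oo) !=set0.
  by apply: compact_csquare; exists 0%N => // n _ /=; exact: uc.
have p2 : p.2 = 1.
  apply/eqP; rewrite eq_le; apply/andP; split.
    by have [_] := pc; rewrite ler_norml => /andP[].
  apply/ler_addgt0Pr => e ep.
  have e2 : 0 < e / 2 by rewrite divr_gt0.
  have [x [/= xu xp]] : [set x : plane R | 1 - e / 2 < x.2] `&` [set x
    | x.2 < p.2 + e / 2] !=set0.
    apply: cl.
      exists (Num.truncn (e / 2)^-1) => // n /= en.
      have [[_ /andP[+ _]] _] := uP n; apply: le_lt_trans.
      rewrite lerB// -[leRHS]invrK lef_pV2 ?posrE ?invr_gt0//.
      have := truncnS_gt (e / 2)^-1; move=> /ltW/le_trans; apply.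
      by rewrite ler_nat ltnS; exact: leqW.
    apply: (near_lt (fun x : plane R => x.2) (fun=> p.2 + e / 2)).
    - exact: cvg_snd.
    - exact: cvg_cst.
    - by rewrite ltrDl.
  lra.
have gp : g p = 0 by apply: g0 => //; exact: csquare_edge_top.
have /subspace_continuousP/(_ p pc) gcp := gc.
have nb : \forall x \near within csquare (nbhs p), g x < eps.
  have lt : g p < eps by rewrite gp.
  exact: (cvgr_lt _ gcp _ lt).
have [x [/= [xc xg] xe]] : [set x | csquare x /\ eps <= g x] `&` [set x
  | csquare x -> g x < eps] !=set0.
  apply: cl; last exact: nb.
  by exists 0%N => // n _ /=; split; [exact: uc|have [] := uP n].
by have := xe xc; rewrite ltNge xg.
Qed.

Lemma powR_sqr_inv {R : realType} (N : nat) : (0 < N)%N ->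
  (N ^ 2)%:R `^ (- 2^-1) = N%:R^-1 :> R.
Proof.
by move=> N0; rewrite powRN powR12_sqrt// natrX sqrtr_sqr ger0_norm.
Qed.

Theorem corollary1p2 (R : realType) :
  exists (phi : plane R -> R) (U : set (plane R)) (f : plane R -> R),
    (is_norm phi /\ exists F, is_facet (unit_ball phi) F) /\
    [/\ open U, bounded_set U, pareto_efficient phi U & ~ compatible phi U] /\
    [/\ [bounded f x | x in U], forall x, U x -> 0 < f x
      & {within U, continuous f}] /\
    forall (d : measure_display) (Omega : measurableType d)
      (P : probability Omega R) (X : nat -> Omega -> set (plane R)),
      (forall n, (0 < n)%N -> poisson_process P U (fun x => n%:R * f x) (X n)) ->
      {ae P, forall w,
        ~ exists g : plane R -> R,
            {within closure U, continuous g} /\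
            {uniform closure U,
              (fun n => rescaled_height phi n (X n w)) @ \oo --> g}}.
Proof.
exists stadium, square, (fun=> 1); split; first by split;
  [exact: stadium_norm|exact: stadium_facet].
split.
  split; [exact: open_square|exact: bounded_square|exact: square_efficient|].
  exact: square_incompatible.
split.
  split.
  - by exists 1; split=> // M M1 x _ /=; rewrite normr1 ltW.
  - by move=> *; exact: ltr01.
  - by apply: continuous_subspaceT => x; exact: cst_continuous.
move=> d Omega P X PX.
(* [m] is kept abstract: unfolding it makes the large numerals below be computed
   in unary. *)
have [m mE] : exists m : nat -> nat, forall D, m D = (24 * D.+2)%N.
  by exists (fun D => 24 * D.+2)%N.
have m0 D : (0 < m D)%N by rewrite mE.
(* The strip will depend on [g], hence on [w], so the exceptional sets of all [D] are discarded
   together. *)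
have neg : P.-negligible (\bigcup_D [set w | exists l0, forall l, (l0 <= l)%N ->
    ~ good X D.+2 (m D) l w]).
  by apply: negligible_bigcup => D; apply: whp_negligible;
    exact: (whp_good P X PX D.+2 (m D) isT (mE D)).
apply: negligibleS neg => w /= /contrapT[g [gc gu]]; rewrite closure_square in gc gu.
apply: contrapT => nbad.
have freq D l0 : exists2 l, (l0 <= l)%N & good X D.+2 (m D) l w.
  apply: contrapT => nl; apply: nbad; exists D => //; exists l0 => l ll0 gl.
  by apply: nl; exists l.
have conv eps : 0 < eps -> exists n0, forall n, (n0 <= n)%N -> forall x, csquare x ->
    `|g x - rescaled_height stadium n (X n w) x| < eps.
  move=> e0; pose e := PosNum e0.
  have [|n0 _ h] := gu [set h | forall y, csquare y -> ball (g y) eps (h y)].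
    apply/uniform_nbhs; exists [set xy : R * R | ball xy.1 e%:num xy.2].
    by split; [exact: entourage_ball|].
  by exists n0 => n nn0 x xc; have := h n nn0 x xc; rewrite /ball/=.
have large D l0 : exists l, [/\ (0 < l)%N, (l0 <= l)%N,
    (l0 <= (4 * m D ^ 3 * l) ^ 2)%N & good X D.+2 (m D) l w].
  have [l l0l gl] := freq D l0.+1; exists l.
  have lp : (0 < l)%N by exact: leq_ltn_trans l0l.
  have c0 : (0 < 4 * m D ^ 3)%N by rewrite muln_gt0 expn_gt0 m0.
  split=> //; first exact: ltnW.
  apply: (leq_trans (ltnW l0l)); rewrite -mulnn.
  by apply: (leq_trans (leq_pmull l c0)); rewrite leq_pmulr// muln_gt0 c0.
(* A finite configuration in the open square has height 0 off it, and finite configurations occur at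
   arbitrarily large [n]. *)
have g0 x : csquare x -> ~ square x -> g x = 0.
  move=> xc xs; apply/eqP; rewrite -normr_le0; apply/ler_addgt0Pr => e e0; rewrite add0r.
  have [n0 hn] := conv e e0; have [l [l0 _ ln [fA _ _ _]]] := large 0%N n0.
  have := hn _ ln x xc; rewrite /rescaled_height height_off_square ?mulr0 ?subr0//.
    exact: ltW.
  have np : (0 < (4 * m 0%N ^ 3 * l) ^ 2)%N by rewrite expn_gt0 !muln_gt0/= !m0 l0.
  by have [+ _ _ _] := PX _ np; exact.
(* Half of 1/400: [g] and the approximation error each stay below 1/800 at a point whose rescaled
   height exceeds 1/400. *)
have e800 : 0 < 800^-1 :> R by lra.
have [[|[|D]] // _ Dg] := small_near_top g 800^-1 e800 gc g0.
have [n0 hn] := conv _ e800.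
have [l [l0 _ ln [fA cA sA big]]] := large D n0.
have [a [k [Wa hk kl]]] := high_point D.+2 (m D) l _ (mE D) isT l0 fA cA sA big.
have ac : csquare a by have [a1 a2] : square a := strip_sub_square D.+2 isT a Wa; split;
  exact: ltW.
have := hn _ ln a ac; have := Dg a Wa.
set N := (4 * m D ^ 3 * l)%N in hn kl ln hk *.
have N0 : (0 < N)%N by rewrite !muln_gt0/= !m0 l0.
rewrite /rescaled_height hk powR_sqr_inv// => ga.
have : 400^-1 < N%:R^-1 * k%:R :> R.
  have NR : 0 < N%:R :> R by rewrite ltr0n.
  have h400 : 0 < 400 :> R by lra.
  rewrite mulrC (ltr_pdivlMr _ _ NR) mulrC (ltr_pdivrMr _ _ h400) mulrC.
  by move: kl; rewrite -(ltr_nat R) natrM.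
by rewrite ltr_norml; lra.
Qed.
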